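(* The Continuous Skolem problem reduces to the LTI Set Reachability problem restricted to instances in which the input set is the singleton $U=\{z\}$ with $z=(1,\ldots,1)$, the matrix $A$ is stable, and the target set is a compact convex set of dimension $n-1$, where $n$ is the dimension of the LTI system.
   Context: Continuous Skolem problem: given a matrix $A\in\mathbb{R}^{n\times n}$ and vectors $c,b\in\mathbb{R}^n$ with rational (or algebraic) entries, decide whether there exists $t\geqslant 0$ such that $c^Te^{At}b=0$. A continuous-time linear time-invariant (LTI) system of dimension $n$ with $m$ inputs is given by a matrix $A\in\mathbb{R}^{n\times n}$, a control matrix $B\in\mathbb{R}^{n\times m}$, both with real algebraic entries, and a control (input) set $U\subseteq\mathbb{R}^m$. Its evolution is $x'(t)=Ax(t)+Bu(t)$ with $u$ a measurable function into $U$. A state $x_0\in\mathbb{R}^n$ can reach $y\in\mathbb{R}^n$ if there exist $T\geqslant 0$ and a measurable control $u:[0,T]\to U$ such that the unique solution of $x'(t)=Ax(t)+Bu(t)$ on $(0,T)$ with $x(0)=x_0$ satisfies $x(T)=y$. LTI Set Reachability problem: given an LTI system and an (effectively described) target set $Y\subseteq\mathbb{R}^n$, decide whether there exists $y\in Y$ such that the origin $\mathbf{0}$ can reach $y$. A matrix is stable if all its eigenvalues have negative real part. A problem $P$ reduces to a problem $Q$ if there is an algorithm transforming instances of $P$ into instances of $Q$ with the same answer, up to negating the answer. *)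

(* Defs.v *)
From HB Require Import structures.
From mathcomp Require Import all_boot all_order all_algebra.
From mathcomp Require Import all_classical all_reals all_analysis.
From mathcomp Require Import complex.

Set Implicit Arguments.
Unset Strict Implicit.
Unset Printing Implicit Defensive.

Import Order.TTheory GRing.Theory Num.Theory.
Import numFieldNormedType.Exports.

Local Open Scope classical_set_scope.
Local Open Scope ring_scope.

(* Total recursive functions on the data types generated by nat, pairs and
   lists: closure of the basic operations under composition, pairing,
   structural recursion on nat and seq, and minimization of regular functions
   (Kleene's general recursive functions, with lists and pairs primitive
   instead of Goedel-numbered). All rules are parametric in the carrier types
   and the only closed data they introduce are 0 and the empty list, so
   instantiating a carrier with another type yields no further function
   between such data types. *)
Inductive computable : forall A B : Type, (A -> B) -> Prop :=
| computable_id (A : Type) : computable (fun x : A => x)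
| computable_comp (A B C : Type) (f : A -> B) (g : B -> C) :
    computable f -> computable g -> computable (fun x => g (f x))
| computable_fst (A B : Type) : computable (fun x : A * B => x.1)
| computable_snd (A B : Type) : computable (fun x : A * B => x.2)
| computable_pair (A B C : Type) (f : A -> B) (g : A -> C) :
    computable f -> computable g -> computable (fun x => (f x, g x))
| computable_zero (A : Type) : computable (fun _ : A => 0%N)
| computable_succ : computable S
| computable_iteri (A B : Type) (f : A -> B) (g : A * (nat * B) -> B) :
    computable f -> computable g ->
    computable (fun x : A * nat =>
      iteri x.2 (fun k r => g (x.1, (k, r))) (f x.1))
| computable_nil (A B : Type) : computable (fun _ : A => [::] : seq B)
| computable_cons (A : Type) : computable (fun x : A * seq A => x.1 :: x.2)
| computable_foldr (A B C : Type) (f : A -> C) (g : A * (B * C) -> C) :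
    computable f -> computable g ->
    computable (fun x : A * seq B =>
      foldr (fun b r => g (x.1, (b, r))) (f x.1) x.2)
| computable_mu (A : Type) (f : A * nat -> nat) (h : A -> nat) :
    computable f ->
    (forall a, f (a, h a) = 0%N) ->
    (forall a k, (k < h a)%N -> f (a, k) <> 0%N) ->
    computable h.

(* A decision problem: answer is only meaningful on the instances that satisfy
   valid. *)
Record problem := Problem {
  instance : Type;
  valid : instance -> Prop;
  answer : instance -> Prop }.

Definition restrict (P : problem) (C : instance P -> Prop) : problem :=
  Problem (fun x => valid x /\ C x) (@answer P).

Definition reduces_to (P Q : problem) : Prop :=
  exists f : instance P -> instance Q,
    [/\ computable f,
        forall x, valid x -> valid (f x) &
        (forall x, valid x -> (answer x <-> answer (f x))) \/
        (forall x, valid x -> (answer x <-> ~ answer (f x)))].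

(* (a, b) stands for a - b, and ((a, b), d) for (a - b) / (d + 1) *)
Definition intcode : Type := (nat * nat)%type.
Definition ratcode : Type := (intcode * nat)%type.

(* A real algebraic number is given by the coefficients, constant term first,
   of an integer polynomial and by the end points of a closed rational interval
   in which the number is the only root of that polynomial. *)
Definition algcode : Type := (seq intcode * (ratcode * ratcode))%type.

(* A term is a product of algebraic constants and of a monomial, the latter
   given by its exponent vector. *)
Definition termcode : Type := (seq algcode * seq nat)%type.
Definition polycode : Type := seq termcode.

(* A semialgebraic set is a finite union of cells, and a cell (E, G) is
   {x | p(x) = 0 for p in E and p(x) > 0 for p in G}. *)
Definition cellcode : Type := (seq polycode * seq polycode)%type.
Definition semialgcode : Type := seq cellcode.

Definition mxcode : Type := seq (seq algcode).

Section decoding.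
Variable R : realType.

Definition intval (c : intcode) : int := c.1%:Z - c.2%:Z.

Definition ratval (c : ratcode) : R := (intval c.1)%:~R / c.2.+1%:R.

Definition algpoly (c : algcode) : {poly R} :=
  Poly [seq (intval z)%:~R | z <- c.1].

Definition algroot (c : algcode) (x : R) : Prop :=
  [/\ algpoly c != 0, root (algpoly c) x & ratval c.2.1 <= x <= ratval c.2.2].

Definition alg_wf (c : algcode) : Prop := exists! x, algroot c x.

Definition algval (c : algcode) : R := xget 0 [set x | algroot c x].

Definition alg0 : algcode := ([::], ((0, 0, 0), (0, 0, 0)))%N.

Definition col_wf (n : nat) (s : seq algcode) : Prop :=
  size s = n /\ forall a : algcode, a \in s -> alg_wf a.

Definition colval (n : nat) (s : seq algcode) : 'cV[R]_n :=
  \col_i algval (nth alg0 s i).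

Definition mx_wf (m n : nat) (M : mxcode) : Prop :=
  size M = m /\ forall s : seq algcode, s \in M -> col_wf n s.

Definition mxval (m n : nat) (M : mxcode) : 'M[R]_(m, n) :=
  \matrix_(i, j) algval (nth alg0 (nth [::] M i) j).

Definition term_wf (n : nat) (t : termcode) : Prop :=
  size t.2 = n /\ forall a : algcode, a \in t.1 -> alg_wf a.

Definition termval (n : nat) (t : termcode) (x : 'cV[R]_n) : R :=
  (\prod_(a <- t.1) algval a) * \prod_(i < n) x i 0 ^+ nth 0%N t.2 i.

Definition poly_wf (n : nat) (p : polycode) : Prop :=
  forall t : termcode, t \in p -> term_wf n t.

Definition polyval (n : nat) (p : polycode) (x : 'cV[R]_n) : R :=
  \sum_(t <- p) termval t x.

Definition semialg_wf (n : nat) (S : semialgcode) : Prop :=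
  forall C : cellcode, C \in S -> forall p : polycode, p \in C.1 ++ C.2 -> poly_wf n p.

Definition semialgval (n : nat) (S : semialgcode) : set 'cV[R]_n :=
  [set x | exists2 C : cellcode, C \in S &
    (forall p : polycode, p \in C.1 -> polyval p x = 0) /\
    (forall p : polycode, p \in C.2 -> 0 < polyval p x)].

End decoding.

Arguments semialgval : clear implicits.

Section skolem.
Variable R : realType.

Definition expmx (n : nat) (A : 'M[R]_n) : 'M[R]_n :=
  \matrix_(i, j) limn (series (fun k => (A ^+ k) i j / k`!%:R)).

(* An instance (n, (A, (c, b))) *)
Definition continuous_skolem : problem :=
  @Problem (nat * (mxcode * (seq algcode * seq algcode)))
    (fun I => let: (n, (A, (c, b))) := I in
      [/\ mx_wf R n n A, col_wf R n c & col_wf R n b])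
    (fun I => let: (n, (A, (c, b))) := I in
      exists2 t : R, 0 <= t &
        (colval R n c)^T *m expmx (t *: mxval R n n A) *m colval R n b = 0).

End skolem.

Section lti.
Variable R : realType.

Local Notation mu := (@lebesgue_measure R).

(* Caratheodory solutions on [0, T] of x' = A x + B u with x 0 = x0, through
   the integral equation, since u is only assumed to be measurable. *)
Definition lti_solution (n m : nat) (A : 'M[R]_n) (B : 'M[R]_(n, m))
    (u : R -> 'cV[R]_m) (T : R) (x0 : 'cV[R]_n) (x : R -> 'cV[R]_n) : Prop :=
  forall i : 'I_n,
    mu.-integrable `[0, T] (fun s => ((A *m x s + B *m u s) i 0)%:E) /\
    forall t, 0 <= t <= T ->
      x t i 0 = x0 i 0 + \int[mu]_(s in `[0, t]) (A *m x s + B *m u s) i 0.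

Definition lti_reach (n m : nat) (A : 'M[R]_n) (B : 'M[R]_(n, m))
    (U : set 'cV[R]_m) (x0 y : 'cV[R]_n) : Prop :=
  exists (T : R) (u : R -> 'cV[R]_m) (x : R -> 'cV[R]_n),
    [/\ 0 <= T,
        (forall t, 0 <= t <= T -> U (u t)) /\
        (forall j, measurable_fun `[0, T] (fun t => u t j 0)),
        lti_solution A B u T x0 x & x T = y].

(* An instance ((n, m), ((A, B), (U, Y))) *)
Definition lti_instance : Type :=
  ((nat * nat) * ((mxcode * mxcode) * (semialgcode * semialgcode)))%type.

Definition lti_set_reachability : problem :=
  @Problem lti_instance
    (fun I => let: ((n, m), ((A, B), (U, Y))) := I in
      [/\ mx_wf R n n A, mx_wf R n m B, semialg_wf R m U & semialg_wf R n Y])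
    (fun I => let: ((n, m), ((A, B), (U, Y))) := I in
      exists2 y, semialgval R n Y y &
        lti_reach (mxval R n n A) (mxval R n m B) (semialgval R m U) 0 y).

Definition stable (n : nat) (A : 'M[R]_n) : Prop :=
  forall z : R[i], eigenvalue (map_mx (real_complex R) A) z -> complex.Re z < 0.

(* Y is nonempty and its affine hull has dimension d: W is the direction of the
   affine hull, i.e. the smallest subspace containing all differences. *)
Definition affine_dim (n : nat) (Y : set 'cV[R]_n) (d : nat) : Prop :=
  Y !=set0 /\
  exists W : {vspace 'cV[R]_n},
    [/\ forall x y, Y x -> Y y -> x - y \in W,
        forall W' : {vspace 'cV[R]_n},
          (forall x y, Y x -> Y y -> x - y \in W') -> (W <= W')%VS &
        \dim W = d].

(* The dimension condition is d = n - 1 without truncation, hence 0 < n. *)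
Definition restricted_instance (I : lti_instance) : Prop :=
  let: ((n, m), ((A, B), (U, Y))) := I in
  [/\ semialgval R m U = [set const_mx 1 : 'cV[R]_m],
      stable (mxval R n n A),
      compact (semialgval R n Y),
      convex_set (semialgval R n Y) &
      exists2 d, affine_dim (semialgval R n Y) d & d.+1 = n].

Definition restricted_lti_set_reachability : problem :=
  @restrict lti_set_reachability restricted_instance.

End lti.

(* Main.v *)
(* For [lam > norm A] put [w t = e^(- lam t) e^(A t) b], which decays and has the
   same zeros of [c^T w] as the Skolem function. Its primitive [xi] satisfies
   [xi' = (A - lam) xi + b = w] with [xi 0 = 0], so that
   [c^T w t = c^T ((A - lam) xi t + b)] is an affine function of the state of a
   stable system started at the origin, and row diagonal dominance confines [xi]
   to an explicit ball. Adding a coordinate [y] that stays 0 along the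
   trajectory, the zeros are the hits of the graph of
   [y = - c^T ((A - lam) xi + b)] over that ball. A graph over a ball is compact,
   convex and of codimension one whatever [A], [b] and [c] are, so degenerate
   instances ([c = 0], [n = 0]) need no separate treatment. *)

Require Import Defs.
From HB Require Import structures.
From mathcomp Require Import all_boot all_order all_algebra.
From mathcomp Require Import all_classical all_reals all_analysis.
From mathcomp Require Import complex.
From mathcomp Require Import ring lra zify.

Set Implicit Arguments.
Unset Strict Implicit.
Unset Printing Implicit Defensive.

Import Order.TTheory GRing.Theory Num.Theory.
Import numFieldNormedType.Exports.

Local Open Scope classical_set_scope.
Local Open Scope ring_scope.

(** * Closure properties of computable functions *)

(** The obstacle lies in the codes: the map must be computable, and adding or multiplying algebraic
    numbers given by isolating intervals would call for resultants and root separation. The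
    construction avoids such arithmetic altogether. The state is doubled so that the entries of
    [A - lam] need not be formed. Products of entries of [c] with entries of [A] and [b] are left to
    the terms of the target polynomial, which carry lists of constants. The rate [lam] and the
    radius are natural numbers read off the end points of the isolating intervals, which dominate
    entrywise 1-norms. Conversely, an arbitrary control and Caratheodory solution reaching the
    target must be identified with the explicit trajectory, hence the uniqueness proof for the
    integral equation. *)

Section computability.
Local Open Scope nat_scope.

(** The constructors fix the shape of a function; extensionality lets a proof exhibit a convenient
    recursion and transfer it. *)
Lemma eq_computable (A B : Type) (f g : A -> B) :
  f =1 g -> computable f -> computable g.
Proof. by move=> /funext ->. Qed.

Lemma computable_proj1 (X A B : Type) (f : X -> A * B) :
  computable f -> computable (fun x => (f x).1).
Proof. by move=> cf; exact: (computable_comp cf (@computable_fst A B)). Qed.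

Lemma computable_proj2 (X A B : Type) (f : X -> A * B) :
  computable f -> computable (fun x => (f x).2).
Proof. by move=> cf; exact: (computable_comp cf (@computable_snd A B)). Qed.

Lemma computable_S (X : Type) (f : X -> nat) :
  computable f -> computable (fun x => (f x).+1).
Proof. by move=> cf; exact: (computable_comp cf computable_succ). Qed.

Lemma computable_nat (X : Type) (k : nat) : computable (fun _ : X => k).
Proof.
by elim: k => [|k IH]; [exact: computable_zero|exact: computable_S].
Qed.

(** The whole context [x] is passed as the parameter of the recursion, so that count, base and step
    may all depend on it. *)
Lemma computable_iter (X B : Type) (n : X -> nat) (f : X -> B)
    (g : X -> nat -> B -> B) :
  computable n -> computable f ->
  computable (fun p : X * (nat * B) => g p.1 p.2.1 p.2.2) ->
  computable (fun x => iteri (n x) (g x) (f x)).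
Proof.
move=> cn cf cg.
exact: (computable_comp (computable_pair (computable_id X) cn)
                        (computable_iteri cf cg)).
Qed.

Lemma computable_foldr_seq (X B C : Type) (s : X -> seq B) (f : X -> C)
    (g : X -> B -> C -> C) :
  computable s -> computable f ->
  computable (fun p : X * (B * C) => g p.1 p.2.1 p.2.2) ->
  computable (fun x => foldr (g x) (f x) (s x)).
Proof.
move=> cs cf cg.
exact: (computable_comp (computable_pair (computable_id X) cs)
                        (computable_foldr cf cg)).
Qed.

Lemma computable_consr (X B : Type) (f : X -> B) (s : X -> seq B) :
  computable f -> computable s -> computable (fun x => f x :: s x).
Proof.
move=> cf cs.
exact: (computable_comp (computable_pair cf cs) (@computable_cons B)).
Qed.

(** Booleans enter only through [nat_of_bool]: a conditional is an iteration run zero times or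
    once. *)
Lemma computable_cond (X B : Type) (b : X -> bool) (f g : X -> B) :
  computable (fun x => nat_of_bool (b x)) -> computable f -> computable g ->
  computable (fun x => if b x then f x else g x).
Proof.
move=> cb cf cg.
apply: (eq_computable (f := fun x => iteri (b x) (fun _ _ => f x) (g x))).
  by move=> x; case: (b x).
apply: computable_iter => //.
by apply: (computable_comp (@computable_fst _ _) cf).
Qed.

Lemma computable_addn (X : Type) (f g : X -> nat) :
  computable f -> computable g -> computable (fun x => f x + g x).
Proof.
move=> cf cg.
apply: (eq_computable (f := fun x => iteri (g x) (fun _ r => r.+1) (f x))).
  by move=> x; elim: (g x) => [|k /= ->]; rewrite ?addn0 ?addnS.
apply: computable_iter => //.
by do !apply: computable_S; do !apply: computable_proj2; exact: computable_id.
Qed.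

Lemma computable_muln (X : Type) (f g : X -> nat) :
  computable f -> computable g -> computable (fun x => f x * g x).
Proof.
move=> cf cg.
apply: (eq_computable (f := fun x => iteri (g x) (fun _ r => r + f x) 0)).
  by move=> x; elim: (g x) => [|k /= ->]; rewrite ?muln0 // mulnS addnC.
apply: computable_iter => //; first exact: computable_zero.
apply: computable_addn; first by do !apply: computable_proj2; exact: computable_id.
by apply: (computable_comp (@computable_fst _ _) cf).
Qed.

Lemma computable_subn (X : Type) (f g : X -> nat) :
  computable f -> computable g -> computable (fun x => f x - g x).
Proof.
move=> cf cg.
apply: (eq_computable (f := fun x => iteri (g x) (fun _ r => r.-1) (f x))).
  by move=> x; elim: (g x) => [|k /= ->]; rewrite ?subn0 ?subnS.
apply: computable_iter => //.
apply: (computable_comp (f := fun p : X * (nat * nat) => p.2.2) (g := predn)).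
  by do !apply: computable_proj2; exact: computable_id.
(* The predecessor is the last index seen by the iteration. *)
apply: (eq_computable (f := fun n => iteri n (fun k _ => k) 0)); first by case.
apply: computable_iter; [exact: computable_id|exact: computable_zero|].
by apply: computable_proj1; apply: computable_proj2; exact: computable_id.
Qed.

Lemma computable_leq (X : Type) (f g : X -> nat) :
  computable f -> computable g -> computable (fun x => nat_of_bool (f x <= g x)).
Proof.
move=> cf cg.
apply: (eq_computable
  (f := fun x => iteri (f x - g x) (fun _ _ => 0) 1)).
  by move=> x; rewrite /leq; case: (_ - _).
apply: computable_iter; [exact: computable_subn|exact: computable_nat|].
exact: computable_zero.
Qed.

Lemma computable_andb (X : Type) (b c : X -> bool) :
  computable (fun x => nat_of_bool (b x)) ->
  computable (fun x => nat_of_bool (c x)) ->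
  computable (fun x => nat_of_bool (b x && c x)).
Proof.
move=> cb cc; apply: (eq_computable (f := fun x => b x * c x)).
  by move=> x; rewrite mulnb.
exact: computable_muln.
Qed.

Lemma computable_eqn (X : Type) (f g : X -> nat) :
  computable f -> computable g -> computable (fun x => nat_of_bool (f x == g x)).
Proof.
move=> cf cg.
apply: (eq_computable (f := fun x => nat_of_bool ((f x <= g x) && (g x <= f x)))).
  by move=> x; rewrite eqn_leq.
by apply: computable_andb; apply: computable_leq.
Qed.

Lemma computable_cat (X B : Type) (s t : X -> seq B) :
  computable s -> computable t -> computable (fun x => s x ++ t x).
Proof.
move=> cs ct.
apply: (eq_computable (f := fun x => foldr (fun a r => a :: r) (t x) (s x))).
  by move=> x; elim: (s x) => //= a r ->.
apply: computable_foldr_seq => //; apply: computable_consr.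
  by apply: computable_proj1; apply: computable_proj2; exact: computable_id.
by do !apply: computable_proj2; exact: computable_id.
Qed.

Lemma computable_flatten (X B : Type) (s : X -> seq (seq B)) :
  computable s -> computable (fun x => flatten (s x)).
Proof.
move=> cs; apply: computable_foldr_seq => //; first exact: computable_nil.
apply: computable_cat.
  by apply: computable_proj1; apply: computable_proj2; exact: computable_id.
by do !apply: computable_proj2; exact: computable_id.
Qed.

Lemma computable_mkseq (X B : Type) (f : X -> nat -> B) (n : X -> nat) :
  computable (fun p : X * nat => f p.1 p.2) -> computable n ->
  computable (fun x => mkseq (f x) (n x)).
Proof.
move=> cf cn.
apply: (eq_computable
  (f := fun x => iteri (n x) (fun k r => r ++ [:: f x k]) [::])).
  by move=> x; elim: (n x) => //= k ->; rewrite mkseqS cats1.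
apply: computable_iter => //; first exact: computable_nil.
apply: computable_cat; first by do !apply: computable_proj2; exact: computable_id.
apply: computable_consr; last exact: computable_nil.
apply: (computable_comp (f := fun p : X * (nat * seq B) => (p.1, p.2.1)) _ cf).
apply: computable_pair; first exact: computable_fst.
by apply: computable_proj1; exact: computable_snd.
Qed.

Lemma computable_sumn (X B : Type) (f : X -> B -> nat) (s : X -> seq B) :
  computable s -> computable (fun p : X * B => f p.1 p.2) ->
  computable (fun x => sumn (map (f x) (s x))).
Proof.
move=> cs cf.
apply: (eq_computable (f := fun x => foldr (fun a r => f x a + r) 0 (s x))).
  by move=> x; elim: (s x) => //= a r ->.
apply: computable_foldr_seq => //; first exact: computable_zero.
apply: computable_addn; last by do !apply: computable_proj2; exact: computable_id.
apply: (computable_comp (f := fun p : X * (B * nat) => (p.1, p.2.1)) _ cf).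
apply: computable_pair; first exact: computable_fst.
by apply: computable_proj1; exact: computable_snd.
Qed.

(** The step of [foldr] does not see the tail, so the fold carries the pair of the list rebuilt so
    far and its tail. *)
Lemma computable_behead (B : Type) : computable (@behead B).
Proof.
pose f (s : seq B) := foldr (fun a r => (a :: r.1, r.1)) ([::], [::]) s.
have fE s : f s = (s, behead s) by elim: s => //= a r ->.
apply: (eq_computable (f := fun s => (f s).2)); first by move=> s; rewrite fE.
apply: computable_proj2; apply: computable_foldr_seq.
- exact: computable_id.
- by apply: computable_pair; exact: computable_nil.
have c2 : computable (fun p : seq B * (B * (seq B * seq B)) => p.2.2.1).
  by apply: computable_proj1; do !apply: computable_proj2; exact: computable_id.
apply: computable_pair => //; apply: computable_consr => //.
by apply: computable_proj1; exact: computable_snd.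
Qed.

Lemma computable_nth (X B : Type) (d : X -> B) (s : X -> seq B) (n : X -> nat) :
  computable d -> computable s -> computable n ->
  computable (fun x => nth (d x) (s x) (n x)).
Proof.
move=> cd cs cn.
(* Iterated [behead] drops the prefix; a fold that ignores its accumulator then returns the head, or
   the default on the empty list. *)
apply: (eq_computable (f := fun x => foldr (fun a _ => a) (d x)
  (iteri (n x) (fun _ r => behead r) (s x)))).
  move=> x; rewrite -[in RHS](addn0 (n x)) -nth_drop.
  suff -> : drop (n x) (s x) = iteri (n x) (fun _ r => behead r) (s x)
    by case: (iteri (n x) (fun _ r => behead r) (s x)).
  elim: (n x) => [|k IH]; first exact: drop0.
  by rewrite /= -IH -drop1 drop_drop add1n.
apply: computable_foldr_seq => //.
  apply: computable_iter => //.
  by apply: computable_comp (@computable_behead B); do !apply: computable_proj2;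
    exact: computable_id.
by apply: computable_proj1; exact: computable_snd.
Qed.

End computability.

(** * The reduction on codes *)

Section reduction.
Local Open Scope nat_scope.

(** The integer [z] as the root of [X - z] in a one-point interval; swapping the components of [z]
    negates it. *)
Definition zcode (z : intcode) : algcode :=
  ([:: (z.2, z.1); (1, 0)], ((z, 0), (z, 0))).

(** Denominators are at least 1, so the numerators alone bound both end points, hence the root
    between them. *)
Definition algbound (c : algcode) : nat :=
  c.2.1.1.1 + c.2.1.1.2 + (c.2.2.1.1 + c.2.2.1.2).

Definition vecbound (s : seq algcode) : nat := sumn (map algbound s).

Definition mxbound (M : mxcode) : nat := sumn (map vecbound M).

(** The bound is doubled because the doubled system contains the matrix twice; the successor makes
    the domination strict. *)
Definition decay (M : mxcode) : nat := (mxbound M + mxbound M).+1.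

(** Convertible to [1 + (n + n)], so that decoded matrices are block matrices without casts. Index 0
    is the graph coordinate, [1..n] and [n+1..2n] are the two copies of the state. *)
Definition sys_dim (n : nat) : nat := (n + n).+1.

(** The off-diagonal blocks let each copy be driven by the other through [A], while [- lam] sits on
    the diagonal. *)
Definition drift_entry (n : nat) (A : mxcode) (i j : nat) : algcode :=
  if i == j then zcode (0, decay A)
  else if (0 < i) && (i <= n) && (n < j) then
    nth (zcode (0, 0)) (nth [::] A (i - 1)) (j - n.+1)
  else if (n < i) && (0 < j) && (j <= n) then
    nth (zcode (0, 0)) (nth [::] A (i - n.+1)) (j - 1)
  else zcode (0, 0).

Definition drift (n : nat) (A : mxcode) : mxcode :=
  mkseq (fun i => mkseq (drift_entry n A i) (sys_dim n)) (sys_dim n).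

Definition input_entry (n : nat) (b : seq algcode) (i : nat) : algcode :=
  if (0 < i) && (i <= n) then nth (zcode (0, 0)) b (i - 1)
  else if n < i then nth (zcode (0, 0)) b (i - n.+1)
  else zcode (0, 0).

Definition input (n : nat) (b : seq algcode) : mxcode :=
  mkseq (fun i => [:: input_entry n b i]) (sys_dim n).

(** The monomial [x_i ^ k]; [k = 0] gives the constant monomial. *)
Definition unit_exponent (n k i : nat) : seq nat :=
  mkseq (fun j => k * nat_of_bool (j == i)) n.

(** The graph coordinate plus [c^T] applied to the right-hand side of the first copy, whose rows are
    [1..n]. Each product of constants stays a list of factors. *)
Definition graph_poly (n : nat) (A : mxcode) (c b : seq algcode) : polycode :=
  ([::], unit_exponent (sys_dim n) 1 0) ::
  flatten (mkseq (fun i =>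
    ([:: nth (zcode (0, 0)) c i; input_entry n b i.+1], unit_exponent (sys_dim n) 0 0) ::
    mkseq (fun j => ([:: nth (zcode (0, 0)) c i; drift_entry n A i.+1 j],
                    unit_exponent (sys_dim n) 1 j)) (sys_dim n)) n).

(** The factor [n.+1] comes from [norm1_position] and 2 from the two copies; the successor keeps the
    radius positive when [b = 0] or [n = 0], so that the dimension of the target does not drop. *)
Definition radius (n : nat) (b : seq algcode) : nat :=
  (2 * n.+1 * vecbound b).+1.

Definition ball_poly (n : nat) (b : seq algcode) : polycode :=
  ([:: zcode (radius n b * radius n b, 0)], unit_exponent (sys_dim n) 0 0) ::
  mkseq (fun j => ([:: zcode (0, 1)], unit_exponent (sys_dim n) 2 j.+1)) (n + n).

(* The closed ball is the union of its interior and its sphere, since a cell only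
   allows strict inequalities. *)
Definition target (n : nat) (A : mxcode) (c b : seq algcode) : semialgcode :=
  [:: ([:: graph_poly n A c b], [:: ball_poly n b]);
      ([:: graph_poly n A c b; ball_poly n b], [::])].

Definition singleton_one : semialgcode :=
  [:: ([:: [:: ([::], [:: 1]); ([:: zcode (0, 1)], [:: 0])]], [::])].

Definition reduction (I : nat * (mxcode * (seq algcode * seq algcode))) :
    lti_instance :=
  ((sys_dim I.1, 1),
   ((drift I.1 I.2.1, input I.1 I.2.2.2),
    (singleton_one, target I.1 I.2.1 I.2.2.1 I.2.2.2))).

Ltac computable_step :=
  cbv beta;
  lazymatch goal with
  | |- computable (fun _ => nat_of_bool (_ && _)) => apply: computable_andb
  | |- computable (fun _ => nat_of_bool (leq _ _)) => apply: computable_leq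
  | |- computable (fun _ => nat_of_bool (eq_op _ _)) => apply: computable_eqn
  | |- computable (fun x => x) => exact: computable_id
  | |- computable fst => exact: computable_fst
  | |- computable snd => exact: computable_snd
  | |- computable (fun _ => fst _) => apply: computable_proj1
  | |- computable (fun _ => snd _) => apply: computable_proj2
  | |- computable (fun _ => if _ then _ else _) => apply: computable_cond
  | |- computable (fun _ => pair _ _) => apply: computable_pair
  | |- computable (fun _ => nil) => exact: computable_nil
  | |- computable (fun _ => cons _ _) => apply: computable_consr
  | |- computable (fun _ => flatten _) => apply: computable_flatten
  | |- computable (fun _ => mkseq _ _) => apply: computable_mkseq
  | |- computable (fun _ => nth _ _ _) => apply: computable_nth
  | |- computable (fun _ => sumn _) => apply: computable_sumn
  | |- computable (fun _ => O) => exact: computable_zero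
  | |- computable (fun _ => S _) => apply: computable_S
  | |- computable (fun _ => addn _ _) => apply: computable_addn
  | |- computable (fun _ => subn _ _) => apply: computable_subn
  | |- computable (fun _ => muln _ _) => apply: computable_muln
  end.

Lemma computable_vecbound (X : Type) (b : X -> seq algcode) :
  computable b -> computable (fun x => vecbound (b x)).
Proof.
by move=> cb; apply: computable_sumn => //; rewrite /algbound; repeat computable_step.
Qed.

Lemma computable_zcode (X : Type) (z : X -> intcode) :
  computable z -> computable (fun x => zcode (z x)).
Proof. by move=> cz; rewrite /zcode; repeat (assumption || computable_step). Qed.

Lemma computable_unit_exponent (X : Type) (k : nat) (n i : X -> nat) :
  computable n -> computable i ->
  computable (fun x => unit_exponent (n x) k (i x)).
Proof.
move=> cn ci; apply: computable_mkseq => //.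
apply: computable_muln; first exact: computable_nat.
apply: computable_eqn; first exact: computable_snd.
exact: (computable_comp (@computable_fst X nat) ci).
Qed.

Lemma computable_mxbound (X : Type) (A : X -> mxcode) :
  computable A -> computable (fun x => mxbound (A x)).
Proof.
move=> cA; apply: computable_sumn => //.
by apply: computable_vecbound; exact: computable_snd.
Qed.

Lemma computable_decay (X : Type) (A : X -> mxcode) :
  computable A -> computable (fun x => decay (A x)).
Proof.
by move=> cA; apply: computable_S; apply: computable_addn; exact: computable_mxbound.
Qed.

Lemma computable_drift_entry (X : Type) (n i j : X -> nat) (A : X -> mxcode) :
  computable n -> computable i -> computable j -> computable A ->
  computable (fun x => drift_entry (n x) (A x) (i x) (j x)).
Proof.
move=> cn ci cj cA; rewrite /drift_entry.
repeat first [assumption | apply: computable_zcode | apply: computable_decay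
             | computable_step].
Qed.

Lemma computable_input_entry (X : Type) (n i : X -> nat) (b : X -> seq algcode) :
  computable n -> computable i -> computable b ->
  computable (fun x => input_entry (n x) (b x) (i x)).
Proof.
move=> cn ci cb; rewrite /input_entry.
by repeat first [assumption | apply: computable_zcode | computable_step].
Qed.

Lemma computable_reduction : computable reduction.
Proof.
rewrite /reduction /drift /input /singleton_one /target /graph_poly /ball_poly
  /radius.
repeat first [apply: computable_zcode | apply: computable_drift_entry
  | apply: computable_input_entry | apply: computable_unit_exponent
  | apply: computable_vecbound | computable_step | rewrite /sys_dim].
Qed.

End reduction.

(** * The matrix exponential *)

Section matrix_exponential.
Variable R : realType.

(** Chosen because it bounds every row sum, is additive over blocks, and is bounded entry by entry
    from the codes. *)
Definition norm1_mx (m n : nat) (A : 'M[R]_(m, n)) : R := \sum_i \sum_j `|A i j|.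

Lemma le_norm1_row (m n : nat) (A : 'M[R]_(m, n)) (i : 'I_m) :
  \sum_j `|A i j| <= norm1_mx A.
Proof.
by rewrite /norm1_mx (bigD1 i)//= lerDl sumr_ge0// => k _; exact: sumr_ge0.
Qed.

Lemma norm1_mx_ge0 (m n : nat) (A : 'M[R]_(m, n)) : 0 <= norm1_mx A.
Proof. by apply: sumr_ge0 => i _; exact: sumr_ge0. Qed.

Lemma normr_expmx_entry (n : nat) (A : 'M[R]_n) (k : nat) (i j : 'I_n) :
  `|(A ^+ k) i j| <= norm1_mx A ^+ k.
Proof.
elim: k i => [|k IH] i; first by rewrite !expr0 mxE; case: (i == j); rewrite ?normr1 ?normr0.
rewrite exprS mxE (le_trans (ler_norm_sum _ _ _))// exprS.
apply: le_trans (ler_wpM2r (exprn_ge0 _ (norm1_mx_ge0 A)) (le_norm1_row A i)).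
by rewrite mulr_suml ler_sum// => l _; rewrite normrM ler_wpM2l.
Qed.

Definition expmx_coeff (n : nat) (A : 'M[R]_n) (i j : 'I_n) (k : nat) : R :=
  (A ^+ k) i j / k`!%:R.

(** Each entry becomes a scalar power series in [t], to which termwise differentiation applies. *)
Lemma expmx_pseries (n : nat) (A : 'M[R]_n) (t : R) (i j : 'I_n) :
  expmx (t *: A) i j = limn (pseries (expmx_coeff A i j) t).
Proof.
rewrite mxE /pseries; congr (limn (series _)); apply/funext => k.
suff -> : (t *: A) ^+ k = t ^+ k *: A ^+ k by rewrite /expmx_coeff mxE -mulrA mulrC.
elim: k => [|k IH]; first by rewrite !expr0 scale1r.
by rewrite !exprS IH -[LHS]/(_ *m _) -scalemxAl -scalemxAr scalerA.
Qed.

Lemma normr_expmx_coeff (n : nat) (A : 'M[R]_n) (i j : 'I_n) (k : nat) (t : R) :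
  `|expmx_coeff A i j k * t ^+ k| <= exp_coeff (norm1_mx A * `|t|) k.
Proof.
rewrite /expmx_coeff /exp_coeff /= !normrM normrX normfV [`|_%:R|]ger0_norm//.
by rewrite mulrAC exprMn ler_wpM2r// ler_wpM2r ?exprn_ge0// normr_expmx_entry.
Qed.

Lemma is_cvg_normed_expmx (n : nat) (A : 'M[R]_n) (i j : 'I_n) (t : R) :
  cvgn [normed pseries (expmx_coeff A i j) t].
Proof.
apply: (@series_le_cvg _ _ (exp_coeff (norm1_mx A * `|t|))) => [k|k|k|].
- exact: normr_ge0.
- by rewrite exp_coeff_ge0// mulr_ge0// norm1_mx_ge0.
- exact: normr_expmx_coeff.
- exact: is_cvg_series_exp_coeff.
Qed.

Lemma is_cvg_expmx (n : nat) (A : 'M[R]_n) (i j : 'I_n) (t : R) :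
  cvgn (pseries (expmx_coeff A i j) t).
Proof. exact/normed_cvg/is_cvg_normed_expmx. Qed.

Lemma normr_expmx (n : nat) (A : 'M[R]_n) (t : R) (i j : 'I_n) :
  `|expmx (t *: A) i j| <= expR (norm1_mx A * `|t|).
Proof.
rewrite expmx_pseries.
apply: le_trans (lim_series_norm (@is_cvg_normed_expmx n A i j t)) _.
apply: lim_series_le; [exact: is_cvg_normed_expmx|exact: is_cvg_series_exp_coeff|].
by move=> k; exact: normr_expmx_coeff.
Qed.

(** The formal derivative is again a linear combination of coefficient sequences of the same kind,
    so the derived series converge without new estimates. *)
Lemma expmx_coeff_diffs (n : nat) (A : 'M[R]_n) (i j : 'I_n) :
  pseries_diffs (expmx_coeff A i j) =
  fun k => \sum_l A i l * expmx_coeff A l j k.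
Proof.
apply/funext => k; rewrite /pseries_diffs /expmx_coeff exprS factS natrM mxE.
rewrite invfM mulrCA mulVKf ?pnatr_eq0// mulr_suml.
by under eq_bigr do rewrite -mulrA.
Qed.

Lemma cvg_sum_expmx (n : nat) (A : 'M[R]_n) (u : 'I_n -> R) (j : 'I_n) (t : R) :
  pseries (fun k => \sum_l u l * expmx_coeff A l j k) t @ \oo -->
  \sum_l u l * expmx (t *: A) l j.
Proof.
have -> : pseries (fun k => \sum_l u l * expmx_coeff A l j k) t =
    (fun N => \sum_l u l * pseries (expmx_coeff A l j) t N).
  apply/funext => N; rewrite /pseries /series/=.
  under [RHS]eq_bigr do rewrite mulr_sumr.
  rewrite exchange_big/=; apply: eq_bigr => k _.
  by rewrite mulr_suml; apply: eq_bigr => l _; rewrite mulrA.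
have add_cont : continuous (fun p : R * R => p.1 + p.2) by exact: add_continuous.
apply: cvg_big => [//|l _]; apply: cvgM; [exact: cvg_cst|rewrite expmx_pseries].
exact: is_cvg_expmx.
Qed.

Lemma is_derive_expmx (n : nat) (A : 'M[R]_n) (t : R) (i j : 'I_n) :
  is_derive t 1 (fun s => expmx (s *: A) i j)
    (\sum_l A i l * expmx (t *: A) l j).
Proof.
have -> : (fun s => expmx (s *: A) i j) =
    (fun s => limn (pseries (expmx_coeff A i j) s)).
  by apply/funext => s; exact: expmx_pseries.
have := @cvg_sum_expmx n A (A i) j t; rewrite -expmx_coeff_diffs => /cvg_lim <- //.
(* The series and its first two formal derivatives must converge at a point of modulus greater than
   that of [t]. *)
apply: (@pseries_snd_diffs _ _ (`|t| + 1)).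
- exact: is_cvg_expmx.
- by rewrite expmx_coeff_diffs; apply/cvg_ex; eexists; exact: cvg_sum_expmx.
- have -> : pseries_diffs (pseries_diffs (expmx_coeff A i j)) =
      fun k => \sum_l (\sum_p A i p * A p l) * expmx_coeff A l j k.
    rewrite expmx_coeff_diffs; apply/funext => k; rewrite /pseries_diffs mulr_sumr.
    under eq_bigr => l _.
      rewrite mulrCA -[_.+1%:R * _]/(pseries_diffs _ k) expmx_coeff_diffs mulr_sumr.
      over.
    rewrite exchange_big/=; apply: eq_bigr => l _; rewrite mulr_suml.
    by apply: eq_bigr => p _; rewrite mulrA.
  by apply/cvg_ex; eexists; exact: cvg_sum_expmx.
- by rewrite [ltRHS]ger0_norm ?addr_ge0// ltrDl.
Qed.

Lemma expmx0 (n : nat) (A : 'M[R]_n) : expmx (0 *: A) = 1%:M.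
Proof.
apply/matrixP => i j; rewrite expmx_pseries; apply/cvg_lim => //.
(* Once the empty partial sum is dropped the sequence is constant: at 0 only the term of index 0
   survives. *)
rewrite -cvg_shiftS.
rewrite (_ : [sequence _]_n = fun=> (1%:M : 'M[R]_n) i j); first exact: cvg_cst.
apply/funext => k; rewrite /pseries /series/= big_nat_recl//= big1 => [|l _].
  by rewrite /expmx_coeff !expr0 fact0 divr1 mulr1 addr0.
by rewrite expr0n mulr0.
Qed.

End matrix_exponential.

(** * Trajectories *)

Section lebesgue_segment.
Variable R : realType.
Local Notation mu := (@lebesgue_measure R).

Lemma continuous_integrable_segment (f : R -> R) (a b : R) :
  continuous f -> mu.-integrable `[a, b] (EFin \o f).
Proof.
move=> cf; apply: (@continuous_compact_integrable R f `[a, b]%classic).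
  exact: segment_compact.
exact: continuous_subspaceT.
Qed.

Lemma is_derive_continuous (F f : R -> R) :
  (forall s : R, is_derive s 1 F (f s)) -> continuous F.
Proof.
move=> dF s; apply/differentiable_continuous/derivable1_diffP.
by have [] := dF s.
Qed.

Lemma Rintegral_is_derive (F f : R -> R) (t : R) : 0 <= t ->
  (forall s : R, is_derive s 1 F (f s)) -> continuous f ->
  \int[mu]_(s in `[0, t]) f s = F t - F 0.
Proof.
move=> t0 dF cf; have cF := is_derive_continuous dF.
have [<-|t_neq0] := eqVneq 0 t; first by rewrite set_itv1 Rintegral_set1 subrr.
rewrite /Rintegral (@continuous_FTC2 _ f F 0 t)//=.
- by rewrite lt_neqAle t_neq0.
- exact: continuous_subspaceT.
- split => [s _||]; first by have [] := dF s.
  + exact/cvg_at_right_filter/cF.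
  + exact/cvg_at_left_filter/cF.
- by move=> s _; rewrite derive1E; have [_ ->] := dF s.
Qed.

Lemma integrable_lincomb (I : Type) (r : seq I) (D : set R) (u : I -> R)
    (f : I -> R -> R) : measurable D ->
  (forall i, mu.-integrable D (EFin \o f i)) ->
  mu.-integrable D (EFin \o (fun s => \sum_(i <- r) u i * f i s)).
Proof.
move=> mD intf.
have -> : EFin \o (fun s => \sum_(i <- r) u i * f i s) =
    (fun s => \sum_(i <- r) ((u i)%:E * (f i s)%:E))%E.
  by apply/funext => s /=; rewrite -sumEFin.
by apply: integrable_sum => // i _; exact: (@integrableZl _ _ _ mu _ mD _ _ (intf i)).
Qed.

Lemma Rintegral_lincomb (I : Type) (r : seq I) (D : set R) (u : I -> R)
    (f : I -> R -> R) : measurable D ->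
  (forall i, mu.-integrable D (EFin \o f i)) ->
  \int[mu]_(s in D) (\sum_(i <- r) u i * f i s) =
  \sum_(i <- r) u i * \int[mu]_(s in D) f i s.
Proof.
move=> mD intf; elim: r => [|i r IH].
  rewrite big_nil; under eq_Rintegral do rewrite big_nil.
  by rewrite Rintegral_cst// mul0r.
rewrite big_cons -IH; under eq_Rintegral do rewrite big_cons.
rewrite RintegralD//; last exact: integrable_lincomb.
  by rewrite RintegralZl.
by have := @integrable_lincomb _ [:: i] _ u _ mD intf;
  under eq_fun do rewrite big_seq1.
Qed.

End lebesgue_segment.

(** * The damped trajectory and its bound *)

Section trajectory.
Variables (R : realType) (n : nat) (A : 'M[R]_n) (b : 'cV[R]_n) (lam : R).
Local Notation mu := (@lebesgue_measure R).

(** This is [w], and [position] is its primitive [xi]. *)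
Definition velocity (t : R) : 'cV[R]_n := expR (- lam * t) *: (expmx (t *: A) *m b).

Definition position (t : R) : 'cV[R]_n :=
  \col_i \int[mu]_(s in `[0, t]) velocity s i 0.

Lemma is_derive_velocity (t : R) (i : 'I_n) :
  is_derive t 1 (fun s => velocity s i 0)
    (((A - lam%:M) *m velocity t) i 0).
Proof.
have -> : (fun s => velocity s i 0) =
    (fun s => expR (- lam * s)) * \sum_j (fun s => expmx (s *: A) i j * b j 0).
  apply/funext => s; rewrite /velocity !mxE [RHS]/GRing.mul/= fct_sumE.
  by congr (_ * _).
have dlin : is_derive t 1 (fun s => - lam * s) (- lam).
  have := is_deriveZ (- lam) (is_derive_id t (1 : R)).
  by rewrite [_ *: 1]mulr1.
have dexp : is_derive t 1 (fun s => expR (- lam * s)) (expR (- lam * t) * - lam).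
  exact: (is_derive1_comp (is_derive_expR (- lam * t)) dlin).
have dE (j : 'I_n) : is_derive t 1 (fun s => expmx (s *: A) i j * b j 0)
    ((A *m expmx (t *: A)) i j * b j 0).
  have := is_deriveZ (b j 0) (is_derive_expmx A t i j).
  rewrite mxE [_ *: _]mulrC; congr (is_derive _ _ _ _).
  by apply/funext => s; rewrite mulrC.
have := is_deriveM dexp (is_derive_sum dE).
congr (is_derive _ _ _ _).
rewrite fct_sumE -[LHS]/(_ * _ + _ * (_ * _)) mulmxBl mul_scalar_mx.
rewrite /velocity -scalemxAr mulmxA [RHS]mxE !mxE.
rewrite [X in _ + X * _](_ : _ = (expmx (t *: A) *m b) i 0); last by rewrite mxE.
by congr (_ + _); rewrite mxE; ring.
Qed.

Lemma continuous_velocity (i : 'I_n) : continuous (fun t => velocity t i 0).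
Proof. by apply: is_derive_continuous => t; exact: is_derive_velocity. Qed.

Lemma velocity0 : velocity 0 = b.
Proof. by rewrite /velocity mulr0 expR0 scale1r expmx0 mul1mx. Qed.

(** Integrate [w' = (A - lam) w] from 0 to [t], with [w 0 = b]. *)
Lemma position_ode (t : R) : 0 <= t ->
  (A - lam%:M) *m position t + b = velocity t.
Proof.
move=> t0; apply/matrixP => i j; rewrite ord1 {j} -[in RHS](subrK b (velocity t)).
rewrite [LHS]mxE [RHS]mxE; congr (_ + _); rewrite [RHS]mxE [X in _ = _ + X]mxE.
have cf : continuous (fun s => ((A - lam%:M) *m velocity s) i 0).
  move=> s; under eq_fun do rewrite mxE.
  apply: cvg_big => [|j _]; first exact: add_continuous.
  by apply: cvgM; [exact: cvg_cst|exact: continuous_velocity].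
rewrite -velocity0.
rewrite -(Rintegral_is_derive t0 (fun s => is_derive_velocity s i) cf).
under eq_Rintegral do rewrite mxE.
rewrite Rintegral_lincomb//.
  by rewrite mxE; apply: eq_bigr => j _; rewrite [position _ _ _]mxE.
by move=> j; apply: continuous_integrable_segment; exact: continuous_velocity.
Qed.

Hypothesis A_lam : norm1_mx A + 1 <= lam.

(** The growth of [e^(A t)] is at most [e^(norm1_mx A * t)], which the factor [e^(- lam t)]
    absorbs. *)
Lemma normr_velocity (t : R) (i : 'I_n) : 0 <= t ->
  `|velocity t i 0| <= \sum_j `|b j 0|.
Proof.
move=> t0; rewrite /velocity !mxE normrM ger0_norm ?expR_ge0//.
rewrite mulNr expRN mulrC ler_pdivrMr ?expR_gt0// mulr_suml.
apply: le_trans (ler_norm_sum _ _ _) _; apply: ler_sum => j _.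
rewrite normrM mulrC ler_wpM2l//.
apply: le_trans (normr_expmx _ _ _ _) _.
by rewrite ler_expR ger0_norm// ler_wpM2r// (le_trans _ A_lam)// lerDl.
Qed.

(** No integral is estimated: the equation gives [lam xi = A xi + b - w]. Summing over the rows, [b]
    contributes its norm once and [w] at most once per row, whence [n.+1]; since
    [lam - norm1_mx A >= 1], the term in [A] is absorbed on the left. *)
Lemma norm1_position (t : R) : 0 <= t ->
  \sum_i `|position t i 0| <= n.+1%:R * \sum_j `|b j 0|.
Proof.
move=> t0; set m := \sum_i _; set s := \sum_j _.
have m0 : 0 <= m by exact: sumr_ge0.
have lam0 : 0 <= lam by apply: le_trans A_lam; rewrite addr_ge0// norm1_mx_ge0.
have row i : lam * `|position t i 0| <=
    (\sum_j `|A i j|) * m + (`|b i 0| + s).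
  have /matrixP/(_ i 0) := position_ode t0.
  rewrite mulmxBl mul_scalar_mx 3!mxE => E.
  have {E} E : lam * position t i 0 = (\sum_j A i j * position t j 0) +
      (b i 0 - velocity t i 0).
    have -> : lam * position t i 0 = - (- (lam *: position t)) i 0.
      by rewrite 2![in RHS]mxE opprK.
    by rewrite -E; ring.
  rewrite -[X in X * _](ger0_norm lam0) -normrM E.
  apply: le_trans (ler_normD _ _) _; apply: lerD.
    apply: le_trans (ler_norm_sum _ _ _) _; rewrite mulr_suml.
    apply: ler_sum => j _; rewrite normrM ler_wpM2l// /m.
    by rewrite (bigD1 j)//= lerDl sumr_ge0.
  by apply: le_trans (ler_normB _ _) _; rewrite lerD2l normr_velocity.
have : lam * m <= norm1_mx A * m + n.+1%:R * s.
  rewrite mulr_sumr; apply: le_trans (ler_sum _ (fun i _ => row i)) _.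
  rewrite big_split/= -mulr_suml lerD2l big_split/= sumr_const card_ord.
  by rewrite -[n.+1]add1n natrD mulrDl mul1r mulr_natl.
by move: A_lam m0; rewrite -subr_ge0 => h1 h2 h3; nra.
Qed.

End trajectory.

(** * Uniqueness of Caratheodory solutions *)

Section uniqueness.
Variables (R : realType) (n m : nat) (A : 'M[R]_n) (B : 'M[R]_(n, m)).
Variables (u1 u2 : R -> 'cV[R]_m) (T : R) (x0 : 'cV[R]_n) (x1 x2 : R -> 'cV[R]_n).
Hypothesis u12 : forall t, 0 <= t <= T -> u1 t = u2 t.
Hypothesis sol1 : lti_solution A B u1 T x0 x1.
Hypothesis sol2 : lti_solution A B u2 T x0 x2.
Local Notation mu := (@lebesgue_measure R).

Let gap (t : R) : 'cV[R]_n := x1 t - x2 t.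
Let rate (i : 'I_n) (t : R) : R := (A *m gap t) i 0.

Let rateE (i : 'I_n) (t : R) : 0 <= t <= T ->
  rate i t = (A *m x1 t + B *m u1 t) i 0 - (A *m x2 t + B *m u2 t) i 0.
Proof.
by move=> tT; rewrite /rate /gap mulmxBr u12// !mxE; ring.
Qed.

Let subset_segment (t : R) : t <= T -> `[0, t]%classic `<=` (`[0, T]%classic : set R).
Proof. by move=> tT; apply: subset_itvl; rewrite bnd_simp. Qed.

Let integrable_rate (i : 'I_n) (t : R) : t <= T ->
  mu.-integrable `[0, t] (EFin \o rate i).
Proof.
move=> tT; apply: (@integrableS _ _ _ mu `[0, T]) => //; first exact: subset_segment.
have [int1 _] := sol1 i; have [int2 _] := sol2 i.
apply: eq_integrable (integrableB _ int1 int2) => //.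
by move=> s; rewrite inE/= in_itv/= => sT; rewrite rateE// EFinB.
Qed.

Let normr_gap (i : 'I_n) (t : R) : 0 <= t <= T ->
  `|gap t i 0| <= \int[mu]_(s in `[0, t]) `|rate i s|.
Proof.
move=> tT; have /andP[t0 tleT] := tT.
have sub := subset_segment tleT.
have [int1 E1] := sol1 i; have [int2 E2] := sol2 i.
suff -> : gap t i 0 = \int[mu]_(s in `[0, t]) rate i s.
  by apply: le_normr_Rintegral => //; exact: integrable_rate.
transitivity (x1 t i 0 - x2 t i 0); first by rewrite !mxE.
rewrite E1// E2// opprD addrACA subrr add0r -RintegralB//.
- apply: eq_Rintegral => s; rewrite inE/= in_itv/= => /andP[s0 st].
  by rewrite rateE// s0 (le_trans st).
- exact: (@integrableS _ _ _ mu `[0, T]).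
- exact: (@integrableS _ _ _ mu `[0, T]).
Qed.

Let normr_rate (i : 'I_n) (s M : R) : (forall j, `|gap s j 0| <= M) ->
  `|rate i s| <= norm1_mx A * M.
Proof.
move=> gapM; rewrite /rate mxE; apply: le_trans (ler_norm_sum _ _ _) _.
apply: (@le_trans _ _ ((\sum_j `|A i j|) * M)).
  by rewrite mulr_suml; apply: ler_sum => j _; rewrite normrM ler_wpM2l.
rewrite ler_wpM2r ?le_norm1_row//.
exact: le_trans (normr_ge0 _) (gapM i).
Qed.

(** Nothing bounds the solutions a priori; the first bound on the gap comes from the integrability
    of the right-hand sides. *)
Let gap_bound : R := \sum_i \int[mu]_(s in `[0, T]) `|rate i s|.

(* Picard iteration: each pass through the integral equation gains a factor
   [norm1_mx A * t / k.+1]. *)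
Let normr_gap_iter (k : nat) (i : 'I_n) (t : R) : 0 <= t <= T ->
  `|gap t i 0| <= gap_bound * exp_coeff (norm1_mx A * t) k.
Proof.
elim: k i t => [|k IH] i t tT; have /andP[t0 tleT] := tT;
    apply: le_trans (normr_gap i tT) _.
  rewrite /exp_coeff/= expr0 fact0 divr1 mulr1.
  have T0 : 0 <= T by exact: le_trans tleT.
  apply: (@le_trans _ _ (\int[mu]_(s in `[0, T]) `|rate i s|)).
    apply: fine_le.
    - apply: (integrable_fin_num (mu := mu)) => //.
      exact: (integrable_norm (integrable_rate i tleT)).
    - apply: (integrable_fin_num (mu := mu)) => //.
      exact: (integrable_norm (integrable_rate i (lexx T))).
    - apply: ge0_subset_integral => //; last exact: subset_segment.
      by have /integrableP[] := integrable_norm (integrable_rate i (lexx T)).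
  rewrite /gap_bound (bigD1 i)//= lerDl sumr_ge0// => j _.
  exact: Rintegral_ge0.
pose a := norm1_mx A.
(* [F] is the primitive, vanishing at 0, of the bound [f] that the induction hypothesis puts on the
   rate. *)
pose F (s : R) := gap_bound * exp_coeff (a * s) k.+1.
pose f (s : R) := a * (gap_bound * exp_coeff (a * s) k).
have dF (s : R) : is_derive s 1 F (f s).
  have -> : F = (gap_bound * a ^+ k.+1 / k.+1`!%:R) \*: (id ^+ k.+1 : R -> R).
    apply/funext => r; rewrite /F /exp_coeff/= exprMn.
    by rewrite /= exprfctE -[RHS]/(_ * _) [RHS]mulrAC !mulrA.
  have := is_deriveZ (gap_bound * a ^+ k.+1 / k.+1`!%:R)
    (is_deriveX k.+1 (is_derive_id s (1 : R))).
  congr (is_derive _ _ _ _).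
  rewrite /f /exp_coeff/= factS natrM exprS exprMn.
  have k1 : k.+1%:R != 0 :> R by rewrite pnatr_eq0.
  have kf : k`!%:R != 0 :> R by rewrite pnatr_eq0 -lt0n fact_gt0.
  rewrite /= -![_ *: _]/(_ * _ : R) mulr1.
  move: (_.+1%:R) (_`!%:R) k1 kf => p q p0 q0; by field; rewrite q0.
have cf : continuous f.
  have -> : f = (fun s => a * gap_bound * a ^+ k / k`!%:R * s ^+ k).
    by apply/funext => r; rewrite /f /exp_coeff/= exprMn; ring.
  by move=> r; apply: cvgM; [exact: cvg_cst|exact: exprn_continuous].
apply: (@le_trans _ _ (F t - F 0)); last first.
  by rewrite /F /exp_coeff/= mulr0 [0 ^+ _]expr0n mul0r mulr0 subr0.
rewrite -(Rintegral_is_derive t0 dF cf).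
apply: le_Rintegral => //.
- exact: (integrable_norm (integrable_rate i tleT)).
- exact: continuous_integrable_segment.
move=> s; rewrite /= in_itv/= => /andP[s0 st]; apply: normr_rate => j.
by apply: IH; rewrite s0 (le_trans st).
Qed.

(** The iterated bounds are multiples of the terms of a convergent exponential series, so they tend
    to 0. *)
Lemma lti_solution_unique (t : R) : 0 <= t <= T -> x1 t = x2 t.
Proof.
move=> tT; apply/matrixP => i j; rewrite ord1 {j}; apply/eqP.
rewrite -subr_eq0 -normr_le0.
suff : `|gap t i 0| <= 0 by rewrite !mxE.
have cv : (fun k => gap_bound * exp_coeff (norm1_mx A * t) k) @ \oo --> (0 : R).
  rewrite -(mulr0 gap_bound); apply: cvgM; first exact: cvg_cst.
  exact: cvg_exp_coeff.
rewrite -(cvg_lim (@Rhausdorff R) cv).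
apply: limr_ge; first by apply/cvg_ex; exists 0.
by near=> k; exact: normr_gap_iter.
Unshelve. all: by end_near. Qed.

End uniqueness.

(** * The doubled system *)

Section block_system.
Variables (R : realType) (n : nat) (A : 'M[R]_n) (b : 'cV[R]_n) (lam : R).
Local Notation mu := (@lebesgue_measure R).

(* Doubling the state makes every entry of the stabilized matrix either an entry
   of [A] or an integer: on the diagonal [xi = xi'] the two copies follow
   [xi' = (A - lam) xi + b]. *)
Definition block_drift : 'M[R]_(1 + (n + n)) :=
  block_mx (- lam%:M) 0 0 (block_mx (- lam%:M) A A (- lam%:M)).

Definition block_input : 'cV[R]_(1 + (n + n)) := col_mx 0 (col_mx b b).

Definition block_trajectory (t : R) : 'cV[R]_(1 + (n + n)) :=
  col_mx 0 (col_mx (position A b lam t) (position A b lam t)).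

(** Only the rows of the first copy are read; along the trajectory this is [c^T w]. *)
Definition block_output (c : 'cV[R]_n) (x : 'cV[R]_(1 + (n + n))) : R :=
  (c^T *m usubmx (dsubmx (block_drift *m x + block_input))) 0 0.

(** The graph coordinate is absent from the right-hand side, so the target equation can be solved
    for it: this makes the target a graph. *)
Lemma block_output_lin (c : 'cV[R]_n) (x : 'cV[R]_(1 + (n + n))) :
  block_output c x =
  (row_mx (- lam *: c^T) (c^T *m A) *m dsubmx x) 0 0 + (c^T *m b) 0 0.
Proof.
rewrite /block_output -[X in block_drift *m X]vsubmxK mul_block_col.
rewrite -[X in block_mx _ A A _ *m X]vsubmxK mul_block_col !add_col_mx.
rewrite !mul0mx add0r add_col_mx col_mxKd col_mxKu.
rewrite -[X in row_mx _ _ *m X]vsubmxK mul_row_col !mulmxDr !mulmxA.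
by rewrite mulmxN mul_mx_scalar -scaleNr mxE.
Qed.

(** Reduces the integral equation of the doubled system to scalar ones, keeping blocks out of the
    integrals. *)
Lemma block_entry (i : 'I_(1 + (n + n))) :
  (forall x : 'cV[R]_n, col_mx 0 (col_mx x x) i 0 = 0) \/
  exists k, forall x : 'cV[R]_n, col_mx 0 (col_mx x x) i 0 = x k 0.
Proof.
rewrite -(splitK i); case: fintype.split => j /=.
  by left=> x; rewrite col_mxEu mxE.
right; rewrite -(splitK j); case: fintype.split => k /=; exists k => x.
  by rewrite col_mxEd col_mxEu.
by rewrite !col_mxEd.
Qed.

Lemma block_trajectory_ode (t : R) : 0 <= t ->
  block_drift *m block_trajectory t + block_input =
  col_mx 0 (col_mx (velocity A b lam t) (velocity A b lam t)).
Proof.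
move=> t0; rewrite !mul_block_col !add_col_mx !mulmx0 !mul0mx !addr0 add0r.
by rewrite add_col_mx -(position_ode A b lam t0) mulmxBl mulNmx [- _ + _]addrC.
Qed.

Lemma block_trajectory_solution (T : R) : 0 <= T ->
  lti_solution block_drift block_input (fun=> const_mx 1 : 'cV_1) T 0
    block_trajectory.
Proof.
move=> T0 i.
pose v (s : R) := col_mx (0 : 'cV_1) (col_mx (velocity A b lam s) (velocity A b lam s)).
have rhs (s : R) : 0 <= s ->
    block_drift *m block_trajectory s + block_input *m const_mx 1 = v s.
  by move=> s0; rewrite /v -block_trajectory_ode// [const_mx 1]mx11_scalar mxE mulmx1.
have [z|[k zk]] := block_entry i.
- have v0 : (fun s => v s i 0) = cst 0 by apply/funext => s; exact: z.
  have cv : continuous (fun s => v s i 0) by rewrite v0 => s; exact: cvg_cst.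
  split.
    apply: eq_integrable (continuous_integrable_segment 0 T cv) => //.
    by move=> s; rewrite inE/= in_itv/= => /andP[s0 _]; rewrite rhs.
  move=> t /andP[t0 _]; rewrite [in RHS]mxE add0r /block_trajectory z.
  under eq_Rintegral => s.
    rewrite inE/= in_itv/= => /andP[s0 _]; rewrite rhs// /v z; over.
  by rewrite Rintegral_cst// mul0r.
- have vk : (fun s => v s i 0) = (fun s => velocity A b lam s k 0).
    by apply/funext => s; exact: zk.
  have cv : continuous (fun s => v s i 0) by rewrite vk; exact: continuous_velocity.
  split.
    apply: eq_integrable (continuous_integrable_segment 0 T cv) => //.
    by move=> s; rewrite inE/= in_itv/= => /andP[s0 _]; rewrite rhs.
  move=> t /andP[t0 _]; rewrite [in RHS]mxE add0r /block_trajectory zk mxE.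
  apply: eq_Rintegral => s; rewrite inE/= in_itv/= => /andP[s0 _].
  by rewrite rhs// /v zk.
Qed.

End block_system.

(** * Stability by domination of the shift *)

Section stability.
Variable R : realType.

Lemma norm1_block_mx (m1 m2 n1 n2 : nat) (A : 'M[R]_(m1, n1)) (B : 'M[R]_(m1, n2))
    (C : 'M[R]_(m2, n1)) (D : 'M[R]_(m2, n2)) :
  norm1_mx (block_mx A B C D) =
  norm1_mx A + norm1_mx B + (norm1_mx C + norm1_mx D).
Proof.
rewrite /norm1_mx big_split_ord -!big_split /=.
congr (_ + _); apply: eq_bigr => i _; rewrite big_split_ord /=;
  by congr (_ + _); apply: eq_bigr => j _;
    rewrite ?block_mxEul ?block_mxEur ?block_mxEdl ?block_mxEdr.
Qed.

Lemma norm1_mx0 (m n : nat) : norm1_mx (0 : 'M[R]_(m, n)) = 0.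
Proof. by apply: big1 => i _; apply: big1 => j _; rewrite mxE normr0. Qed.

Lemma normc_real (x : R) : `| real_complex R x | = real_complex R `|x|.
Proof. by rewrite normc_def/= expr0n addr0 sqrtr_sqr. Qed.

(** A row eigenvector [v] satisfies [v S = (z + lam) v]; comparing 1-norms gives
    [|z + lam| <= norm1_mx S < lam], so [z] lies in an open disc of centre [- lam] and radius
    [lam]. *)
Lemma stable_sub_scalar (n : nat) (S : 'M[R]_n) (lam : R) :
  norm1_mx S < lam -> stable (S - lam%:M).
Proof.
move=> S_lam z /eigenvalueP[v vM v0].
have vS : v *m map_mx (real_complex R) S = (z + real_complex R lam) *: v.
  rewrite -[S](subrK lam%:M) map_mxD mulmxDr vM scalerDl; congr (_ + _).
  by rewrite map_scalar_mx mul_mx_scalar.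
pose m := \sum_i `|v 0 i|.
have m0 : 0 < m.
  have [i vi] : exists i, v 0 i != 0.
    by apply/existsP; apply: contra_neqT v0 => /existsPn v0; apply/rowP => i;
      rewrite mxE; apply/eqP; rewrite -[_ == _]negbK v0.
  by rewrite /m (bigD1 i)//= ltr_pwDl ?normr_gt0// sumr_ge0.
have : `|z + real_complex R lam| * m <= real_complex R (norm1_mx S) * m.
  rewrite {1}/m mulr_sumr.
  apply: (@le_trans _ _ (\sum_j \sum_i `|v 0 i| * real_complex R `|S i j|)).
    apply: ler_sum => j _; have /rowP/(_ j) := vS; rewrite !mxE -normrM => <-.
    apply: le_trans (ler_norm_sum _ _ _) _; apply: ler_sum => i _.
    by rewrite mxE normrM normc_real.
  rewrite exchange_big/= [X in _ <= X]mulrC mulr_suml; apply: ler_sum => i _.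
  rewrite -mulr_sumr ler_wpM2l// -rmorph_sum/= lecR.
  exact: le_norm1_row.
rewrite ler_pM2r// => /(le_trans (normc_ge_Re _)); rewrite lecR.
case: z {vM vS} => x y /=; rewrite ler_norml => /andP[_ h].
by rewrite -(ltrD2r lam) add0r; exact: le_lt_trans S_lam.
Qed.

Lemma stable_block_drift (n : nat) (A : 'M[R]_n) (lam : R) :
  norm1_mx A + norm1_mx A < lam -> stable (block_drift A lam).
Proof.
move=> A_lam.
have -> : block_drift A lam = block_mx 0 0 0 (block_mx 0 A A 0) - lam%:M.
  by rewrite !scalar_mx_block !opp_block_mx !add_block_mx !oppr0 !addr0 !add0r.
by apply: stable_sub_scalar; rewrite !norm1_block_mx !norm1_mx0 !addr0 !add0r.
Qed.

End stability.

(** * Geometry of the target *)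

Section graph_over_ball.
Variables (R : realType) (N : nat) (L : 'rV[R]_N) (k0 rho : R).
Hypothesis rho_gt0 : 0 < rho.

Definition sqnorm (v : 'cV[R]_N) : R := \sum_j v j 0 ^+ 2.

(** [rho] is the squared radius, which keeps the condition polynomial. *)
Definition graph_ball : set 'cV[R]_(1 + N) :=
  [set y | usubmx y 0 0 + (L *m dsubmx y) 0 0 + k0 = 0 /\ sqnorm (dsubmx y) <= rho].

Definition graph_point (v : 'cV[R]_N) : 'cV[R]_(1 + N) :=
  col_mx (- (L *m v) - k0%:M) v.

Lemma graph_ballP (y : 'cV[R]_(1 + N)) :
  graph_ball y <-> exists2 v, sqnorm v <= rho & y = graph_point v.
Proof.
split=> [[y0 yrho]|[v vrho ->]].
  exists (dsubmx y) => //; rewrite -[LHS]vsubmxK; congr col_mx.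
  apply/matrixP => i j; rewrite !ord1 !mxE eqxx mulr1n.
  by move: y0; rewrite !mxE => y0; lra.
rewrite /graph_ball /graph_point /= col_mxKu col_mxKd; split => //.
by rewrite !mxE eqxx mulr1n; ring.
Qed.

Lemma continuous_mx (T : topologicalType) (m n : nat) (f : T -> 'M[R]_(m, n)) :
  (forall i j, continuous (fun x => f x i j)) -> continuous f.
Proof.
move=> cf x; apply/cvg_mx_entourageP => A entA.
apply: filter_forall => i; apply: filter_forall => j.
have /cvg_entourageP := cf i j x; move/(_ _ entA).
by rewrite !near_map; apply: filterS => y /= ?; rewrite inE.
Qed.

Lemma continuous_affine (T : topologicalType) (u : 'I_N -> R) (c : R)
    (f : 'I_N -> T -> R) :
  (forall i, continuous (f i)) -> continuous (fun x => \sum_i u i * f i x + c).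
Proof.
move=> cf x; apply: cvgD; last exact: cvg_cst.
apply: cvg_big => [|i _]; first exact: add_continuous.
by apply: cvgM; [exact: cvg_cst|exact: cf].
Qed.

Lemma continuous_sumsq (T : topologicalType) (f : 'I_N -> T -> R) :
  (forall i, continuous (f i)) -> continuous (fun x => \sum_i f i x ^+ 2).
Proof.
move=> cf x; apply: cvg_big => [|i _]; first exact: add_continuous.
by under eq_fun do rewrite expr2; apply: cvgM; exact: cf.
Qed.

Lemma compact_graph_ball : compact graph_ball.
Proof.
(* The ball is moved to row vectors, where [bounded_closed_compact] is applied. *)
pose K : set 'rV[R]_N := [set v | sqnorm v^T <= rho].
have -> : graph_ball = (fun v : 'rV[R]_N => graph_point v^T) @` K.
  apply/seteqP; split => [y /graph_ballP[v vK ->]|y [v vK <-]].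
    by exists v^T; rewrite ?trmxK//= /K/= trmxK.
  by apply/graph_ballP; exists v^T.
have coord (j : 'I_N) : continuous (fun v : 'rV[R]_N => v^T j 0).
  rewrite (_ : (fun v => _) = (fun v : 'rV[R]_N => v 0 j)).
    exact: coord_continuous.
  by apply/funext => v; rewrite mxE.
apply: continuous_compact.
  apply: continuous_subspaceT; apply: continuous_mx => i j.
  rewrite -(splitK i); case: fintype.split => l /=.
    rewrite (_ : (fun v => _) = (fun v : 'rV[R]_N =>
      \sum_q (- L 0 q) * v^T q 0 + - k0)); first exact: continuous_affine.
    apply/funext => v; rewrite /graph_point col_mxEu !ord1 !mxE eqxx mulr1n.
    by rewrite -sumrN; under eq_bigr do rewrite -mulNr.
  rewrite (_ : (fun v => _) = (fun v : 'rV[R]_N => v^T l 0)); first exact: coord.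
  by apply/funext => v; rewrite /graph_point col_mxEd ord1.
apply: bounded_closed_compact.
  (* [M > 1 + rho] gives [M ^ 2 > rho], so no square root is needed. *)
  exists (1 + rho); split; first exact: num_real.
  move=> M rhoM v vK /=; rewrite [leLHS]/Num.norm/= mx_normrE; apply/bigmax_leP.
  have M0 : 0 <= M by rewrite (le_trans _ (ltW rhoM))// addr_ge0// ltW.
  split => // -[i j] _ /=; rewrite ord1.
  have : v 0 j ^+ 2 <= rho.
    apply: le_trans vK; rewrite /sqnorm (bigD1 j)//= mxE lerDl.
    by apply: sumr_ge0 => q _; exact: sqr_ge0.
  rewrite -real_normK ?num_real// => h.
  have := normr_ge0 (v 0 j); nra.
rewrite (_ : K = (fun v : 'rV[R]_N => sqnorm v^T) @^-1` [set x | x <= rho])//.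
apply: closed_comp => [v _|]; last exact: closed_le.
by move: v; exact: continuous_sumsq.
Qed.

Lemma convex_graph_ball : convex_set graph_ball.
Proof.
move=> x y p; rewrite !inE => /graph_ballP[v vrho ->] /graph_ballP[w wrho ->].
set t : R := p%:num; have t0 : 0 <= t by rewrite /t ge0.
have t1 : t <= 1 by rewrite /t le1.
apply/graph_ballP; exists (t *: v + (1 - t) *: w).
  apply: (@le_trans _ _ (t * sqnorm v + (1 - t) * sqnorm w)); last by nra.
  rewrite !mulr_sumr -big_split; apply: ler_sum => j _ /=; rewrite !mxE.
  rewrite -subr_ge0.
  (* The convexity defect of the square. *)
  rewrite (_ : _ - _ = t * (1 - t) * (v j 0 - w j 0) ^+ 2); last by ring.
  by rewrite mulr_ge0 ?sqr_ge0// mulr_ge0// subr_ge0.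
rewrite -[LHS]/(t *: (graph_point v : 'cV[R]_(1 + N)) + (1 - t) *: graph_point w).
rewrite /graph_point !scale_col_mx add_col_mx; congr col_mx.
rewrite mulmxDr -!scalemxAr; apply/matrixP => i j; rewrite !mxE; ring.
Qed.

(** The direction is the image of the injective map [v |-> (- L v, v)]. It is minimal because every
    [v], once scaled into the ball, gives a difference with the point above the centre. *)
Lemma affine_dim_graph_ball : affine_dim graph_ball N.
Proof.
have sq0 : sqnorm 0 <= rho.
  by rewrite /sqnorm big1 ?ltW// => j _; rewrite mxE expr0n.
split; first by exists (graph_point 0); apply/graph_ballP; exists 0.
pose f (v : 'cV[R]_N) : 'cV[R]_(1 + N) := col_mx (- L) 1%:M *m v.
have fE v w : graph_point v - graph_point w = f (v - w).
  rewrite /f mul_col_mx mul1mx /graph_point opp_col_mx add_col_mx; congr col_mx.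
  by rewrite mulNmx mulmxBr; apply/matrixP => i j; rewrite !mxE; ring.
have fL v : linfun (mulmx (col_mx (- L) 1%:M)) v = f v by rewrite lfunE.
exists (limg (linfun (mulmx (col_mx (- L) 1%:M : 'M[R]_(1 + N, N)) :
   'cV[R]_N -> 'cV[R]_(1 + N)))); split.
- move=> x y /graph_ballP[v _ ->] /graph_ballP[w _ ->].
  by rewrite fE -fL memv_img// memvf.
- move=> W' W'P; apply/subvP => _ /memv_imgP[v _ ->]; rewrite fL.
  have s0 : 0 <= sqnorm v by apply: sumr_ge0 => j _; exact: sqr_ge0.
  (* Both [eps <= 1] and [eps * sqnorm v <= rho] hold, hence [eps ^ 2 * sqnorm v <= rho]. *)
  pose eps := rho / (rho + sqnorm v + 1).
  have den0 : 0 < rho + sqnorm v + 1 by rewrite ltr_wpDl// addr_ge0// ltW.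
  have eps0 : 0 < eps by rewrite divr_gt0.
  have eps1 : eps <= 1 by rewrite ler_pdivrMr// mul1r; lra.
  have epsv : sqnorm (eps *: v) <= rho.
    rewrite (_ : sqnorm _ = eps * (eps * sqnorm v)).
      apply: (@le_trans _ _ (eps * sqnorm v)).
        by rewrite ler_piMl// mulr_ge0// ltW.
      by rewrite /eps mulrAC ler_pdivrMr// ler_wpM2l// ?ltW// addrAC ltrDr addr_gt0.
    rewrite mulrA /sqnorm mulr_sumr; apply: eq_bigr => j _; rewrite !mxE; ring.
  have : graph_point (eps *: v) - graph_point 0 \in W'.
    by apply: W'P; apply/graph_ballP; [exists (eps *: v)|exists 0].
  rewrite fE subr0 /f -scalemxAr => /(memvZ eps^-1).
  by rewrite scalerA mulVf ?scale1r// gt_eqF.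
- have := limg_ker_dim (linfun (mulmx (col_mx (- L) 1%:M : 'M[R]_(1 + N, N)) :
   'cV[R]_N -> 'cV[R]_(1 + N))) fullv.
  rewrite (_ : lker _ = 0%VS) ?capv0 ?dimv0 ?add0n => [->|].
    by rewrite dimvf /dim/= muln1.
  apply/eqP/lker0P => v w; rewrite !fL /f !mul_col_mx !mul1mx.
  by move=> /eq_col_mx[].
Qed.

End graph_over_ball.

(** * Decoding *)

Section decoding.
Variable R : realType.

Lemma horner_zcode (z : intcode) (x : R) :
  (algpoly R (zcode z)).[x] = x - (intval z)%:~R.
Proof.
rewrite /algpoly /= horner_cons horner_cons horner0.
by rewrite /intval/= subr0 mul0r add0r mul1r; congr (_ + _); rewrite -rmorphN opprB.
Qed.

Lemma ratval_nat0 (z : intcode) : ratval R (z, 0%N) = (intval z)%:~R.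
Proof. by rewrite /ratval divr1. Qed.

Lemma algroot_zcode (z : intcode) (x : R) :
  algroot (zcode z) x <-> x = (intval z)%:~R.
Proof.
split=> [[_ /rootP + _]|->]; first by rewrite horner_zcode => /subr0_eq.
split; last by rewrite /= ratval_nat0 lexx.
  apply/eqP => p0; have := horner_zcode z ((intval z)%:~R + 1).
  by rewrite p0 horner0 addrAC subrr add0r => /esym/eqP; rewrite oner_eq0.
by apply/rootP; rewrite horner_zcode subrr.
Qed.

Lemma alg_wf_zcode (z : intcode) : alg_wf R (zcode z).
Proof.
exists (intval z)%:~R; split=> [|x /algroot_zcode ->//].
exact/algroot_zcode.
Qed.

Lemma algvalP (c : algcode) : alg_wf R c -> algroot c (algval R c).
Proof. by move=> [x [cx _]]; apply: (xgetPex 0); exists x. Qed.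

Lemma algval_zcode (z : intcode) : algval R (zcode z) = (intval z)%:~R.
Proof. exact/algroot_zcode/algvalP/alg_wf_zcode. Qed.

Lemma normr_ratval (q : ratcode) : `|ratval R q| <= (q.1.1 + q.1.2)%:R.
Proof.
rewrite /ratval normrM normfV [`|_.+1%:R|]ger0_norm// ler_pdivrMr//.
apply: (@le_trans _ _ (q.1.1 + q.1.2)%:R); last by rewrite ler_peMr// ler1n.
rewrite /intval intrB natrD -!pmulrn (le_trans (ler_normB _ _))//.
by rewrite !ger0_norm.
Qed.

Lemma normr_algval (c : algcode) : alg_wf R c -> `|algval R c| <= (algbound c)%:R.
Proof.
move=> /algvalP[_ _ /andP[lo hi]]; rewrite /algbound natrD ler_norml.
have := normr_ratval c.2.1; have := normr_ratval c.2.2; rewrite !ler_norml.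
move=> /andP[h1 h2] /andP[h3 h4].
have h5 : 0 <= (c.2.1.1.1 + c.2.1.1.2)%:R :> R by [].
have h6 : 0 <= (c.2.2.1.1 + c.2.2.1.2)%:R :> R by [].
by apply/andP; split; lra.
Qed.

Lemma sum_nth (T : Type) (x0 : T) (f : T -> R) (n : nat) (s : seq T) :
  size s = n -> \sum_(i < n) f (nth x0 s i) = \sum_(x <- s) f x.
Proof. by move=> <-; rewrite (big_nth x0) big_mkord. Qed.

Lemma le_sumn (T : eqType) (f : T -> R) (g : T -> nat) (s : seq T) :
  (forall x, x \in s -> f x <= (g x)%:R) ->
  \sum_(x <- s) f x <= (sumn (map g s))%:R.
Proof.
move=> fg; rewrite sumnE big_map natr_sum [leLHS]big_seq [leRHS]big_seq.
exact: ler_sum.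
Qed.

Lemma norm1_colval (n : nat) (s : seq algcode) : col_wf R n s ->
  \sum_i `|colval R n s i 0| <= (vecbound s)%:R.
Proof.
move=> [sn swf]; under eq_bigr do rewrite mxE.
rewrite (sum_nth alg0 (fun c => `|algval R c|) sn).
by apply: le_sumn => c /swf; exact: normr_algval.
Qed.

Lemma norm1_mxval (m n : nat) (M : mxcode) : mx_wf R m n M ->
  norm1_mx (mxval R m n M) <= (mxbound M)%:R.
Proof.
move=> [Mm Mwf].
rewrite [leLHS](_ : _ = \sum_(s <- M) \sum_i `|colval R n s i 0|).
  by apply: le_sumn => s /Mwf; exact: norm1_colval.
rewrite -(sum_nth [::] (fun s => \sum_i `|colval R n s i 0|) Mm).
by apply: eq_bigr => i _; apply: eq_bigr => j _; rewrite !mxE.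
Qed.

Lemma nth_wf (n i : nat) (s : seq algcode) (d : algcode) :
  col_wf R n s -> (i < n)%N -> alg_wf R (nth d s i).
Proof. by move=> [<- swf] i_s; exact/swf/mem_nth. Qed.

Lemma row_wf (m n i : nat) (M : mxcode) :
  mx_wf R m n M -> (i < m)%N -> col_wf R n (nth [::] M i).
Proof. by move=> [<- Mwf] i_s; exact/Mwf/mem_nth. Qed.

Lemma mem_mkseq (T : eqType) (f : nat -> T) (n : nat) (y : T) :
  y \in mkseq f n -> exists2 i, (i < n)%N & y = f i.
Proof. by case/mapP => i; rewrite mem_iota => /= i_n ->; exists i. Qed.

Lemma mkseq_wf (n : nat) (f : nat -> algcode) :
  (forall i, (i < n)%N -> alg_wf R (f i)) -> col_wf R n (mkseq f n).
Proof.
move=> fwf; split=> [|a af]; first by rewrite size_mkseq.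
by case: (mem_mkseq af) => i i_n ->; exact: fwf.
Qed.

Lemma big_mkseq (T : Type) (f : nat -> T) (F : T -> R) (n : nat) :
  \sum_(t <- mkseq f n) F t = \sum_(i < n) F (f i).
Proof. by rewrite /mkseq big_map -{1}(subn0 n) -/(index_iota 0 n) big_mkord. Qed.

Lemma termval_unit (d k : nat) (j : 'I_d) (s : seq algcode) (x : 'cV[R]_d) :
  termval (s, unit_exponent d k j) x = (\prod_(a <- s) algval R a) * x j 0 ^+ k.
Proof.
rewrite /termval /=; congr (_ * _); rewrite (bigD1 j)//= nth_mkseq ?ltn_ord//.
rewrite eqxx muln1 big1 ?mulr1// => i ij.
by rewrite nth_mkseq ?ltn_ord// val_eqE (negbTE ij) muln0.
Qed.

Lemma termval_const (d j : nat) (s : seq algcode) (x : 'cV[R]_d) :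
  termval (s, unit_exponent d 0 j) x = \prod_(a <- s) algval R a.
Proof.
rewrite /termval /= -[RHS]mulr1; congr (_ * _); rewrite big1// => i _.
by rewrite nth_mkseq ?ltn_ord// mul0n.
Qed.

Lemma semialgval_singleton_one :
  semialgval R 1 singleton_one = [set const_mx 1 : 'cV[R]_1].
Proof.
pose p : polycode := [:: ([::], [:: 1%N]); ([:: zcode (0, 1)%N], [:: 0%N])].
have pE (x : 'cV[R]_1) : polyval p x = x 0 0 - 1.
  rewrite /polyval !big_cons big_nil /termval /= !big_cons !big_nil !big_ord1 /=.
  by rewrite algval_zcode /intval expr1 expr0 !mulr1 mul1r addr0 sub0r mulrNz.
apply/seteqP; split => [x [C + []]|x ->].
  rewrite inE => /eqP -> /= /(_ p) + _; rewrite mem_head pE => /(_ isT) x1.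
  by apply/matrixP => i j; rewrite !ord1 mxE; lra.
exists (head ([::], [::]) singleton_one); first exact: mem_head.
split=> q; last by [].
by rewrite inE => /eqP ->; rewrite pE mxE subrr.
Qed.

Lemma semialg_wf_singleton_one : semialg_wf R 1 singleton_one.
Proof.
move=> C; rewrite inE => /eqP -> p; rewrite inE => /eqP -> t.
rewrite !inE => /orP[] /eqP -> ; split => // a.
by rewrite inE => /eqP ->; exact: alg_wf_zcode.
Qed.

(** * Decoding the reduced instance, and its correctness *)

Section system.
Variables (n : nat) (A : mxcode) (b c : seq algcode).
Hypotheses (A_wf : mx_wf R n n A) (b_wf : col_wf R n b) (c_wf : col_wf R n c).

Lemma drift_entry_wf (i j : nat) : (i < sys_dim n)%N -> (j < sys_dim n)%N ->
  alg_wf R (drift_entry n A i j).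
Proof.
rewrite /sys_dim /drift_entry => i_n j_n.
case: ifP => [_|_]; first exact: alg_wf_zcode.
case: ifP => [/andP[/andP[i0 i1] j0]|_].
  by apply: (@nth_wf n); [apply: row_wf|]; [exact: A_wf|lia..].
case: ifP => [/andP[/andP[i0 i1] j0]|_]; last exact: alg_wf_zcode.
by apply: (@nth_wf n); [apply: row_wf|]; [exact: A_wf|lia..].
Qed.

Lemma input_entry_wf (i : nat) : (i < sys_dim n)%N -> alg_wf R (input_entry n b i).
Proof.
rewrite /sys_dim /input_entry => i_n.
case: ifP => [/andP[i0 i1]|_]; first by apply: nth_wf b_wf _; lia.
case: ifP => [i0|_]; last exact: alg_wf_zcode.
by apply: nth_wf b_wf _; lia.
Qed.

Lemma drift_wf : mx_wf R (sys_dim n) (sys_dim n) (drift n A).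
Proof.
split=> [|s sM]; first by rewrite size_mkseq.
case: (mem_mkseq sM) => i i_n ->; apply: mkseq_wf => j; exact: drift_entry_wf.
Qed.

Lemma input_wf : mx_wf R (sys_dim n) 1 (input n b).
Proof.
split=> [|s sM]; first by rewrite size_mkseq.
case: (mem_mkseq sM) => i i_n ->; split=> // a; rewrite inE => /eqP ->.
exact: input_entry_wf.
Qed.

Let M : 'M[R]_n := mxval R n n A.
Let beta : 'cV[R]_n := colval R n b.
Let lam : R := (decay A)%:R.

Lemma algval_nth (d : algcode) (i : nat) (s : seq algcode) (k : 'I_n) :
  col_wf R n s -> i = k -> algval R (nth d s i) = colval R n s k 0.
Proof. by move=> [sn _] ->; rewrite mxE (set_nth_default alg0) ?sn. Qed.

Lemma drift_entryE (i j : 'I_(1 + (n + n))) :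
  algval R (drift_entry n A i j) = block_drift M lam i j.
Proof.
have Mentry (i1 j1 : nat) (k l : 'I_n) : i1 = k -> j1 = l ->
    algval R (nth (zcode (0, 0)%N) (nth [::] A i1) j1) = M k l.
  move=> -> E; rewrite (algval_nth _ (row_wf A_wf (ltn_ord k)) E) !mxE.
  by [].
have z0 : algval R (zcode (0, 0)%N) = 0 by rewrite algval_zcode.
have zl : algval R (zcode (0, decay A)%N) = - lam.
  by rewrite algval_zcode /intval sub0r mulrNz -pmulrn.
rewrite /drift_entry /block_drift -(splitK i) -(splitK j).
case: fintype.split => k; case: fintype.split => l /=.
- by rewrite !ord1 eqxx zl block_mxEul !mxE mulr1n.
- by rewrite ord1 block_mxEur mxE ?ifF ?z0//; lia.
- by rewrite ord1 block_mxEdl mxE /= !ltn0 !andbF /= z0.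
rewrite block_mxEdr -(splitK k) -(splitK l).
case: fintype.split => k'; case: fintype.split => l' /=;
  have := ltn_ord k'; have := ltn_ord l' => l'n k'n.
- rewrite block_mxEul !mxE; have [->|kl] := eqVneq k' l'.
    by rewrite eqxx zl mulr1n.
  rewrite mulr0n oppr0 !ifF ?z0//; try lia.
  by move/negbTE: kl; rewrite -val_eqE /=; lia.
- by rewrite block_mxEur ifF ?ifT; [apply: Mentry|..]; lia.
- rewrite block_mxEdl ifF; last by lia.
  rewrite ifF; last by lia.
  by rewrite ifT; [apply: Mentry|]; lia.
- rewrite block_mxEdr !mxE; have [->|kl] := eqVneq k' l'.
    by rewrite eqxx zl mulr1n.
  rewrite mulr0n oppr0 !ifF ?z0//; try lia.
  by move/negbTE: kl; rewrite -val_eqE /=; lia.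
Qed.

Lemma mxval_drift : mxval R (sys_dim n) (sys_dim n) (drift n A) = block_drift M lam.
Proof.
apply/matrixP => i j; rewrite -drift_entryE mxE nth_mkseq ?ltn_ord//.
by rewrite nth_mkseq ?ltn_ord.
Qed.

Lemma input_entryE (i : 'I_(1 + (n + n))) :
  algval R (input_entry n b i) = block_input beta i 0.
Proof.
rewrite /input_entry /block_input -(splitK i).
case: fintype.split => k /=.
  by rewrite ord1 col_mxEu mxE /= ?ltn0 algval_zcode /intval subrr.
rewrite col_mxEd -(splitK k); case: fintype.split => l /=; have ln := ltn_ord l.
  by rewrite col_mxEu ifT; [apply: algval_nth b_wf _|]; lia.
by rewrite col_mxEd ifF ?ifT; [apply: algval_nth b_wf _|..]; lia.
Qed.

Lemma mxval_input : mxval R (sys_dim n) 1 (input n b) = block_input beta.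
Proof.
apply/matrixP => i j; rewrite ord1 -input_entryE mxE nth_mkseq ?ltn_ord//.
Qed.

Let gamma : 'cV[R]_n := colval R n c.

Lemma graph_polyE (x : 'cV[R]_(1 + (n + n))) :
  @polyval R (sys_dim n) (graph_poly n A c b) x =
  usubmx x 0 0 + block_output M beta lam gamma x.
Proof.
rewrite /polyval big_cons; congr (_ + _).
  rewrite (@termval_unit (sys_dim n) 1 ord0) big_nil mul1r expr1 mxE.
  by congr (x _ _); exact: val_inj.
rewrite big_flatten /= big_mkseq /block_output mxE; apply: eq_bigr => i _.
have ci : algval R (nth (zcode (0, 0)%N) c i) = gamma i 0 by exact: algval_nth.
(* Row [i] of the first copy has index [i.+1], after the graph coordinate. *)
pose r : 'I_(1 + (n + n)) := rshift 1 (lshift n i).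
have ri : r = i.+1 :> nat by [].
rewrite big_cons big_mkseq termval_const !big_cons big_nil mulr1 ci -ri input_entryE.
rewrite !mxE -/r mulrDr addrC; congr (_ + _).
rewrite mulr_sumr; apply: eq_bigr => j _.
rewrite (@termval_unit (sys_dim n) 1 j) !big_cons big_nil mulr1 ci drift_entryE.
by rewrite expr1 [gamma i 0]mxE mulrA.
Qed.

Lemma ball_polyE (x : 'cV[R]_(1 + (n + n))) :
  @polyval R (sys_dim n) (ball_poly n b) x =
  (radius n b)%:R ^+ 2 - sqnorm (dsubmx x).
Proof.
rewrite /polyval big_cons big_mkseq termval_const !big_cons big_nil mulr1.
rewrite algval_zcode /intval subr0 /sqnorm -sumrN; congr (_ + _).
  by rewrite -pmulrn natrM expr2.
apply: eq_bigr => j _.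
rewrite (@termval_unit (sys_dim n) 2 (rshift 1 j)) big_cons big_nil mulr1.
by rewrite algval_zcode /intval sub0r mulrNz mulN1r mxE.
Qed.

Definition slope : 'rV[R]_(n + n) := row_mx (- lam *: gamma^T) (gamma^T *m M).

Lemma semialgval_target : semialgval R (sys_dim n) (target n A c b) =
  graph_ball slope ((gamma^T *m beta) 0 0) ((radius n b)%:R ^+ 2).
Proof.
have gE (x : 'cV[R]_(1 + (n + n))) : @polyval R (sys_dim n) (graph_poly n A c b) x =
    usubmx x 0 0 + (slope *m dsubmx x) 0 0 + (gamma^T *m beta) 0 0.
  by rewrite graph_polyE block_output_lin addrA.
apply/seteqP; split => x; rewrite /graph_ball /= -gE.
  move=> [C]; rewrite !inE => /orP[] /eqP -> /= [E G].
    split; first by apply: E; rewrite mem_head.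
    by have := G (ball_poly n b) (mem_head _ _); rewrite ball_polyE subr_gt0 => /ltW.
  split; first by apply: E; rewrite mem_head.
  have := E (ball_poly n b); rewrite !inE eqxx orbT ball_polyE => /(_ isT)/eqP.
  by rewrite subr_eq0 => /eqP <-.
move=> [x0]; rewrite le_eqVlt => /predU1P[xr|xr].
  exists ([:: graph_poly n A c b; ball_poly n b], [::]).
    by rewrite !inE eqxx orbT.
  by split=> // p; rewrite !inE => /orP[] /eqP -> //; rewrite ball_polyE xr subrr.
exists ([:: graph_poly n A c b], [:: ball_poly n b]); first exact: mem_head.
by split=> p; rewrite inE => /eqP -> //; rewrite ball_polyE subr_gt0.
Qed.

Lemma term_wf_unit (k i : nat) (s : seq algcode) :
  (forall a, a \in s -> alg_wf R a) -> term_wf R (sys_dim n) (s, unit_exponent (sys_dim n) k i).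
Proof. by move=> s_wf; split; rewrite ?size_mkseq. Qed.

Lemma graph_poly_wf : poly_wf R (sys_dim n) (graph_poly n A c b).
Proof.
move=> t; rewrite inE => /orP[/eqP ->|]; first exact: term_wf_unit.
move=> /(elimT flattenP)[s sP ts]; move: ts; case: (mem_mkseq sP) => i i_n ->.
have ci : alg_wf R (nth (zcode (0, 0)%N) c i) by exact: nth_wf c_wf i_n.
have iS : (i.+1 < sys_dim n)%N by rewrite /sys_dim; lia.
rewrite inE => /orP[/eqP ->|tP].
  apply: term_wf_unit => a; rewrite !inE => /orP[] /eqP -> //.
  exact: input_entry_wf.
case: (mem_mkseq tP) => j j_n ->.
apply: term_wf_unit => a; rewrite !inE => /orP[] /eqP -> //.
exact: drift_entry_wf.
Qed.

Lemma ball_poly_wf : poly_wf R (sys_dim n) (ball_poly n b).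
Proof.
move=> t; rewrite inE => /orP[/eqP ->|tP].
  by apply: term_wf_unit => a; rewrite inE => /eqP ->; exact: alg_wf_zcode.
case: (mem_mkseq tP) => j j_n ->.
by apply: term_wf_unit => a; rewrite inE => /eqP ->; exact: alg_wf_zcode.
Qed.

Lemma target_wf : semialg_wf R (sys_dim n) (target n A c b).
Proof.
move=> C CY p pC.
have : p \in [:: graph_poly n A c b; ball_poly n b].
  move: CY pC; rewrite inE => /orP[/eqP -> //|].
  by rewrite mem_seq1 => /eqP ->.
rewrite !inE => /orP[] /eqP ->; [exact: graph_poly_wf|exact: ball_poly_wf].
Qed.

Lemma norm1_le_decay : norm1_mx M + norm1_mx M + 1 <= lam.
Proof.
have h := norm1_mxval A_wf.
by rewrite /lam /decay -addn1 natrD lerD2r natrD lerD.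
Qed.

Lemma drift_bound : norm1_mx M + 1 <= lam.
Proof.
by apply: le_trans norm1_le_decay; rewrite lerD2r lerDl norm1_mx_ge0.
Qed.

Lemma sqnorm_le (N : nat) (v : 'cV[R]_N) : sqnorm v <= (\sum_j `|v j 0|) ^+ 2.
Proof.
rewrite expr2 mulr_suml; apply: ler_sum => j _.
rewrite -real_normK ?num_real// expr2 ler_wpM2l// (bigD1 j)//= lerDl.
exact: sumr_ge0.
Qed.

Lemma sqnorm_trajectory (t : R) : 0 <= t ->
  sqnorm (dsubmx (block_trajectory M beta lam t)) <= (radius n b)%:R ^+ 2.
Proof.
move=> t0; apply: le_trans (sqnorm_le _) _.
rewrite ler_sqr ?nnegrE//; last exact: sumr_ge0.
rewrite /block_trajectory col_mxKd big_split_ord /=.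
under eq_bigr do rewrite col_mxEu.
under [X in _ + X]eq_bigr do rewrite col_mxEd.
have := norm1_position beta drift_bound t0; have := norm1_colval b_wf.
rewrite -/beta; set m := \sum_i `|beta i 0|; set p := \sum_i `|position _ _ _ _ i 0|.
move=> mb pm.
have -> : (radius n b)%:R = 2 * (n.+1%:R * (vecbound b)%:R) + 1 :> R.
  by rewrite /radius -addn1 natrD !natrM mulrA.
have : n.+1%:R * m <= n.+1%:R * (vecbound b)%:R by rewrite ler_wpM2l.
by move: (n.+1%:R * m) (n.+1%:R * _) pm => x y px xy; lra.
Qed.

(** The graph coordinate is 0 on the trajectory, so the target equation reads [c^T w t = 0], and the
    factor [e^(- lam t)] cancels; the ball condition always holds there. *)
Lemma graph_ball_trajectory (t : R) : 0 <= t ->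
  semialgval R (sys_dim n) (target n A c b) (block_trajectory M beta lam t) <->
  gamma^T *m expmx (t *: M) *m beta = 0.
Proof.
move=> t0; have E : gamma^T *m velocity M beta lam t =
    expR (- lam * t) *: (gamma^T *m expmx (t *: M) *m beta).
  by rewrite /velocity -scalemxAr mulmxA.
have O : usubmx (block_trajectory M beta lam t) 0 0 +
    block_output M beta lam gamma (block_trajectory M beta lam t) =
    (gamma^T *m velocity M beta lam t) 0 0.
  rewrite /block_output block_trajectory_ode// col_mxKd col_mxKu.
  by rewrite col_mxKu mxE add0r.
rewrite semialgval_target /graph_ball /= -addrA -block_output_lin O E mxE.
split=> [[/eqP + _]|->].
  rewrite mulf_eq0 gt_eqF ?expR_gt0//= => /eqP h.
  by apply/matrixP => i j; rewrite !ord1 h mxE.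
by rewrite mxE mulr0; split => //; exact: sqnorm_trajectory.
Qed.

Lemma reduction_restricted :
  restricted_instance R (reduction (n, (A, (c, b)))).
Proof.
have rho0 : 0 < (radius n b)%:R ^+ 2 :> R by rewrite exprn_gt0// ltr0n.
split.
- exact: semialgval_singleton_one.
- rewrite mxval_drift; apply: stable_block_drift.
  by apply: lt_le_trans norm1_le_decay; rewrite ltrDl.
- by rewrite semialgval_target; exact: compact_graph_ball.
- by rewrite semialgval_target; exact: convex_graph_ball.
- exists (n + n)%N => //; rewrite semialgval_target.
  exact: affine_dim_graph_ball.
Qed.

Lemma reach_target :
  (exists2 t : R, 0 <= t & gamma^T *m expmx (t *: M) *m beta = 0) <->
  exists2 y, semialgval R (sys_dim n) (target n A c b) y &
    lti_reach (mxval R (sys_dim n) (sys_dim n) (drift n A))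
      (mxval R (sys_dim n) 1 (input n b)) (semialgval R 1 singleton_one) 0 y.
Proof.
rewrite semialgval_singleton_one mxval_drift mxval_input; split.
  move=> [t t0 ht]; exists (block_trajectory M beta lam t).
    exact/graph_ball_trajectory.
  exists t, (fun=> const_mx 1), (block_trajectory M beta lam); split => //.
  exact: block_trajectory_solution.
move=> [y yY [T [u [x [T0 [uU mu_u] sol xT]]]]]; exists T => //.
apply/graph_ball_trajectory => //.
have TT : 0 <= T <= T by rewrite T0 lexx.
(* [uU] forces the control to be constantly 1 on [[0, T]], so the given run is the explicit
   trajectory. *)
rewrite -(lti_solution_unique uU sol (block_trajectory_solution M beta lam T0) TT).
by rewrite xT.
Qed.

End system.

End decoding.

Theorem theorem6p1 (R : realType) :
  reduces_to (continuous_skolem R) (restricted_lti_set_reachability R).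
Proof.
exists reduction; split; first exact: computable_reduction.
  move=> [n [A [c b]]] [A_wf c_wf b_wf]; split; last exact: reduction_restricted.
  split; [exact: drift_wf|exact: input_wf|exact: semialg_wf_singleton_one|].
  exact: target_wf.
by left=> -[n [A [c b]]] [A_wf c_wf b_wf]; exact: reach_target.
Qed.
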